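(* Let $R$ be an associative ring with identity, and let $\mathbf{K}^{\mathcal{F}}$ denote the class of flat left $R$-modules with pure embeddings. Assume $\lambda\geq (|R| + \aleph_0)^+$. If $M \in \mathbf{K}^{\mathcal{F}}$ is a $(\lambda, \omega)$-limit model and $N \in \mathbf{K}^{\mathcal{F}}$ is a $(\lambda, (|R| + \aleph_0)^+)$-limit model, then $M$ and $N^{(\aleph_0)}$ are isomorphic.
   Context: $N^{(\aleph_0)}$ is the direct sum of $\aleph_0$ copies of $N$. $\mathbf{K}^{\mathcal{F}} = (K_{flat}, \leq_{pp})$, where $K_{flat}$ is the class of flat left $R$-modules and $\leq_{pp}$ is the pure submodule relation. $\mathbf{K}^{\mathcal{F}}_{\lambda}$ is the class of flat left $R$-modules of cardinality $\lambda$, and $\mathbf{K}^{\mathcal F}_{\leq\lambda}$ those of cardinality at most $\lambda$. A pure embedding $f: M \to N$ is an isomorphism from $M$ onto a pure submodule of $N$. For $N \leq_{pp} M$ in $\mathbf{K}^{\mathcal{F}}$, $M$ is universal over $N$ if $|M| = |N|=\lambda$ (cardinalities) and for every $N^* \in \mathbf{K}^{\mathcal{F}}_{\leq \lambda}$ with $N \leq_{pp} N^*$ there is a pure embedding $f: N^* \to M$ fixing $N$ pointwise. Let $\lambda$ be an infinite cardinal and $\alpha < \lambda^+$ a limit ordinal. $M$ is a $(\lambda,\alpha)$-limit model if there is a $\leq_{pp}$-increasing continuous chain $\{M_i : i < \alpha\} \subseteq \mathbf{K}^{\mathcal{F}}_\lambda$ (continuous: unions at limit stages) such that $M_{i+1}$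 is universal over $M_i$ for each $i<\alpha$, and $M = \bigcup_{i<\alpha} M_i$. *)

(* Defs.v *)
From HB Require Import structures.
From mathcomp Require Import all_boot all_order all_algebra.
From mathcomp Require Import boolp classical_sets functions cardinality.
From mathcomp.multinomials Require Import freeg.

Set Implicit Arguments.
Unset Strict Implicit.
Unset Printing Implicit Defensive.

Import Order.TTheory GRing.Theory.

Local Open Scope ring_scope.
Local Open Scope quotient_scope.
Local Open Scope classical_set_scope.
Local Open Scope card_scope.

(* A submodule of M is an element of GRing.submodClosed M, the library's
   bundled submodule predicates; [submod S] is S as a module of its own.
   Under the classical axioms of boolp every set of elements is of the form
   [set` P] for some boolean predicate P. *)
Section Submodule.
Context (R : pzRingType) (M : lmodType R) (S : submodClosed M).

Record submod := Submod { submod_val :> M; submod_valP : submod_val \in S }.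

HB.instance Definition _ := [isSub for submod_val].
HB.instance Definition _ := [Choice of submod by <:].
HB.instance Definition _ := [SubChoice_isSubLmodule of submod by <:].

End Submodule.

Definition isomorphic (R : pzRingType) (M N : lmodType R) : Prop :=
  exists f : {linear M -> N}, bijective f.

Section DirectSum.
Context (R : pzRingType) (I : Type) (N : lmodType R).

Definition finsupp_pred : {pred I -> N} :=
  fun x => `[< finite_set [set i | x i != 0] >].

Lemma finsupp_submod_closed : submod_closed finsupp_pred.
Proof.
split=> [|a x y]; rewrite /finsupp_pred !unfold_in.
  apply/asboolP; rewrite (_ : [set _ | _] = set0) //.
  by apply/seteqP; split=> i //=; rewrite eqxx.
move=> /asboolP finx /asboolP finy; apply/asboolP.
apply: (@sub_finite_set _ _ ([set i | x i != 0] `|` [set i | y i != 0])).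
  move=> i /=; case: (eqVneq (x i) 0) => [xi0|]; last by left.
  case: (eqVneq (y i) 0) => [yi0|]; last by right.
  have -> : (a *: x + y) i = a *: x i + y i by [].
  by rewrite xi0 yi0 scaler0 addr0 eqxx.
by rewrite finite_setU.
Qed.

HB.instance Definition _ :=
  GRing.isSubmodClosed.Build R (I -> N) finsupp_pred finsupp_submod_closed.

(* The direct sum of copies of N indexed by I: the finitely supported
   functions inside the product I -> N. *)
Definition direct_sum : lmodType R := submod finsupp_pred.

End DirectSum.

(* The tensor product of a right module A (a left module over the converse
   ring, so that [r *: a] is the right action a r) and a left module M: the free
   abelian group on A * M modulo the subgroup generated by the usual relations. *)
Section Tensor.
Context (R : pzRingType) (M : lmodType R).

Inductive tensor_null (A : lmodType R^c) : {freeg (A * M) / int} -> Prop :=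
| tensor_null0 : tensor_null 0
| tensor_nullB x y : tensor_null x -> tensor_null y -> tensor_null (x - y)
| tensor_nullDl a b m :
    tensor_null (<< (a + b, m) >> - << (a, m) >> - << (b, m) >>)
| tensor_nullDr a m n :
    tensor_null (<< (a, m + n) >> - << (a, m) >> - << (a, n) >>)
| tensor_nullZ (r : R) a m :
    tensor_null (<< ((r : R^c) *: a, m) >> - << (a, r *: m) >>).

Definition tensor_null_pred (A : lmodType R^c) :
  {pred {freeg (A * M) / int}} := fun x => `[< tensor_null x >].

Lemma tensor_null_zmod_closed A : zmod_closed (@tensor_null_pred A).
Proof.
split=> [|x y]; rewrite /tensor_null_pred !unfold_in.
  by apply/asboolP; exact: tensor_null0.
by move=> /asboolP nx /asboolP ny; apply/asboolP; exact: tensor_nullB.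
Qed.

HB.instance Definition _ (A : lmodType R^c) :=
  GRing.isZmodClosed.Build {freeg (A * M) / int} (@tensor_null_pred A)
    (@tensor_null_zmod_closed A).

Definition tensor (A : lmodType R^c) : zmodType :=
  {ideal_quot @tensor_null_pred A}.

Definition tensor_class (A : lmodType R^c) (x : {freeg (A * M) / int}) :
  tensor A := \pi_({ideal_quot @tensor_null_pred A}) x.

Definition tensor_repr (A : lmodType R^c) (x : tensor A) :
  {freeg (A * M) / int} := repr (x : {ideal_quot @tensor_null_pred A}).

Definition tens (A : lmodType R^c) (a : A) (m : M) : tensor A :=
  tensor_class << (a, m) >>.

(* [tensor_map f] is the group morphism induced by f and the identity of M;
   see tensor_map_tens and tensor_map_additive. *)
Definition tensor_map (A B : lmodType R^c) (f : {linear A -> B})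
  (x : tensor A) : tensor B :=
  tensor_class (fglift (fun k : A * M => << (f k.1, k.2) >>) (tensor_repr x)).

Lemma tensor_classP (A : lmodType R^c) (x y : {freeg (A * M) / int}) :
  tensor_class x = tensor_class y <-> tensor_null (x - y).
Proof.
split=> [exy|nxy].
  by apply/asboolP; move/eqP: exy; rewrite -Quotient.idealrBE.
by apply/eqP; rewrite -Quotient.idealrBE; apply/asboolP.
Qed.

Lemma tensor_class_additive (A : lmodType R^c) :
  zmod_morphism (@tensor_class A).
Proof. by move=> x y; exact: (raddfB (\pi_({ideal_quot @tensor_null_pred A}))). Qed.

Lemma tensor_map_class (A B : lmodType R^c) (f : {linear A -> B}) x :
  tensor_map f (tensor_class x) =
  tensor_class (fglift (fun k : A * M => << (f k.1, k.2) >>) x).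
Proof.
set F := fglift _.
have FB : {morph F : u v / u - v} by exact: lift_is_additive.
have FU a m : F << (a, m) >> = << (f a, m) >> by rewrite /F liftU scale1r.
apply/tensor_classP; rewrite -FB.
have : tensor_null (tensor_repr (tensor_class x) - x).
  by apply/tensor_classP; rewrite /tensor_class /tensor_repr reprK.
elim=> {x} [|x y _ IHx _ IHy|a b m|a m n|r a m].
- by rewrite -[0]subr0 FB subrr; exact: tensor_null0.
- by rewrite FB; exact: tensor_nullB.
- by rewrite !FB !FU linearD; exact: tensor_nullDl.
- by rewrite !FB !FU; exact: tensor_nullDr.
- by rewrite FB !FU linearZ; exact: tensor_nullZ.
Qed.

Lemma tensor_map_tens (A B : lmodType R^c) (f : {linear A -> B}) a m :
  tensor_map f (tens a m) = tens (f a) m.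
Proof. by rewrite /tens tensor_map_class liftU scale1r. Qed.

Lemma tensor_map_additive (A B : lmodType R^c) (f : {linear A -> B}) :
  zmod_morphism (tensor_map f).
Proof.
move=> x y; have cK z : tensor_class (tensor_repr z) = z by exact: reprK.
rewrite -[x]cK -[y]cK -tensor_class_additive !tensor_map_class lift_is_additive.
by rewrite tensor_class_additive.
Qed.

Definition flat : Prop :=
  forall (A B : lmodType R^c) (f : {linear A -> B}),
    injective f -> injective (tensor_map f).

End Tensor.
Arguments tensor_map {R} M {A B} f x.

(* The pp-formula exists w, /\_(j < m) \sum_i a j i v_i + \sum_k b j k w_k = 0
   in the free variables v_i, i < n. *)
Record pp_formula (R : Type) (n : nat) := PPFormula {
  pp_eqs : nat;
  pp_vars : nat;
  pp_free : 'M[R]_(pp_eqs, n);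
  pp_bound : 'M[R]_(pp_eqs, pp_vars) }.

Section Pure.
Context (R : pzRingType).

(* The formula is evaluated in the submodule P of M: the witnesses w are taken
   in P. *)
Definition pp_holds (M : lmodType R) (P : set M) n (phi : pp_formula R n)
    (v : 'I_n -> M) : Prop :=
  exists w : 'I_(pp_vars phi) -> M, (forall k, P (w k)) /\
    forall j, \sum_i pp_free phi j i *: v i
              + \sum_k pp_bound phi j k *: w k = 0.

(* P <=_pp Q, for two submodules P and Q of M *)
Definition pure_sub (M : lmodType R) (P Q : set M) : Prop :=
  P `<=` Q /\
  forall n (phi : pp_formula R n) (v : 'I_n -> M), (forall i, P (v i)) ->
    (pp_holds P phi v <-> pp_holds Q phi v).

Definition pure_embedding (M N : lmodType R) (f : {linear M -> N}) : Prop :=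
  injective f /\ pure_sub (range f) setT.

End Pure.

(* Cardinals are represented by types, so L stands for the cardinal lambda. *)
Section LimitModels.
Context (R : pzRingType) (L : Type).

(* T is universal over S, where S and T are submodules of W. A module N
   containing S as a pure submodule is given by a pure embedding j of S. *)
Definition universal_over (W : lmodType R) (S T : submodClosed W) : Prop :=
  [/\ pure_sub [set` S] [set` T],
      [set` S] #= [set: L], [set` T] #= [set: L] &
      forall (N : lmodType R) (j : {linear submod S -> N}),
        flat N -> [set: N] #<= [set: L] -> pure_embedding j ->
        exists f : {linear N -> submod T},
          pure_embedding f /\ forall x : submod S, f (j x) = x :> W].

(* Ordinals are represented by well-founded total orders; they are indexed by
   their own elements, i.e. by the smaller ordinals. *)
Definition is_succ d (I : orderType d) (i j : I) : Prop :=
  (i < j)%O /\ forall k, ~ (i < k < j)%O.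

Definition is_limit d (I : orderType d) (i : I) : Prop :=
  (exists j, (j < i)%O) /\ forall j, ~ is_succ j i.

Definition is_ordinal d (I : orderType d) : Prop :=
  well_founded (fun i j : I => (i < j)%O).

Definition is_limit_ordinal d (I : orderType d) : Prop :=
  [/\ is_ordinal I, exists i : I, True & forall i : I, exists j, (i < j)%O].

(* alpha < lambda^+ is |alpha| <= lambda. *)
Definition limit_model d (alpha : orderType d) (M : lmodType R) : Prop :=
  [/\ infinite_set [set: L],
      is_limit_ordinal alpha,
      [set: alpha] #<= [set: L] &
      exists C : alpha -> submodClosed M,
        [/\ forall i, flat (submod (C i)) /\ [set` C i] #= [set: L],
            forall i j, (i <= j)%O -> pure_sub [set` C i] [set` C j],
            forall i, is_limit i ->
              [set` C i] = \bigcup_(j in [set j | (j < i)%O]) [set` C j],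
            forall i j, is_succ i j -> universal_over (C i) (C j) &
            [set: M] = \bigcup_i [set` C i]]].

End LimitModels.

(* kappa is the successor cardinal |K|^+ seen as an initial ordinal, i.e. the
   least ordinal of cardinality greater than |K|. *)
Definition is_succ_cardinal (K : Type) d (kappa : orderType d) : Prop :=
  [/\ is_ordinal kappa,
      ~~ ([set: kappa] #<= [set: K]) &
      forall i : kappa, [set j | (j < i)%O] #<= [set: K]].

(* Main.v *)
Require Import Defs.
From HB Require Import structures.
From mathcomp Require Import all_boot all_order all_algebra.
From mathcomp Require Import boolp classical_sets functions cardinality.
From mathcomp.multinomials Require Import freeg.

Set Implicit Arguments.
Unset Strict Implicit.
Unset Printing Implicit Defensive.

Import GRing.Theory.
Local Open Scope classical_set_scope.
Local Open Scope card_scope.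

(** Write K for R + nat and N^(n) for the direct sum of n copies of N.  The
    point is that N^(0) <= N^(1) <= ... is itself a chain of universal
    extensions with union N^(aleph_0).  Two such omega-chains have isomorphic
    unions by back and forth: universality alternately supplies pure embeddings
    of one chain into the other, each inverse to the previous one on its image,
    and they glue to an isomorphism (omega_limit_isomorphic).

    To see that N^(n+1) is universal over N^(n), let Q be a flat module of size
    at most lambda containing N^(n) as a pure submodule.  If N^(n) has a
    retraction rho in Q, take any pure embedding u of Q into N and map x to
    (rho x, u (x - rho x)): this fixes N^(n) and is again a pure embedding
    (power_realizes).  The embedding u exists because a universal extension of a
    model S contained in N absorbs S + Q (realizes_absorbs).

    The retraction is where the length |K|^+ of the chain of N is needed.  It is
    enough to prove that N is injective with respect to pure embeddings into
    flat modules: a homomorphism to N from a pure submodule B of a flat module E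
    extends to E (hom_graph_extend).  By Zorn's lemma it suffices to enlarge B
    so as to contain a given x.  A Loewenheim-Skolem argument gives a submodule
    H containing x of size at most |K| such that H is pure in E, B + H is pure
    in E and B meets H in a pure submodule (lowenheim_skolem).  The image of
    the intersection has size at most |K|, and |K|^+ is regular, so this image
    lies in one member S of the chain (succ_cardinal_bounded).  The pushout of S
    and H over the intersection is a flat pure extension of S; by universality
    of the next member T it embeds in T over S, and this embedding extends the
    homomorphism to B + H (hom_graph_step).

    Flatness of the pushout, of pure submodules and of finite sums is read off
    from the equational criterion: M is flat iff every relation A m = 0 in M has
    a reason m = C z with A C = 0 (flatP).  The cardinal arithmetic rests on
    Hessenberg's theorem that the square of an infinite cardinal is itself
    (embeds_square). *)

(** * Cardinal arithmetic *)

(** Zorn's lemma for subsets containing A0: since the empty chain has union set0,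
    it is applied to the sets X for which X `|` A0 satisfies P. *)
Lemma Zorn_above (T : Type) (P : set (set T)) (A0 : set T) :
    P A0 ->
    (forall F : set (set T), F !=set0 -> F `<=` P -> total_on F subset ->
       P (\bigcup_(X in F) X)) ->
  exists A, [/\ A0 `<=` A, P A & forall B, A `<=` B -> P B -> B `<=` A].
Proof.
move=> PA0 PU.
have [F FP Ftot|X [PX maxX]] := @Zorn_bigcup T (fun X => P (X `|` A0)).
  have [->|F0] := eqVneq F set0; first by rewrite bigcup_set0 set0U.
  have -> : \bigcup_(X in F) X `|` A0 = \bigcup_(X in [set Y `|` A0 | Y in F]) X.
    apply/seteqP; split=> [x [[Y FY Yx]|A0x]|x [_ [Y FY <-]] [Yx|]].
    - by exists (Y `|` A0); [exists Y|left].
    - by have /set0P[Y FY] := F0; exists (Y `|` A0); [exists Y|right].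
    - by left; exists Y.
    - by right.
  apply: PU.
  - by have /set0P[Y FY] := F0; exists (Y `|` A0); exists Y.
  - by move=> _ [Y FY <-]; exact: FP.
  - move=> _ _ [Y FY <-] [Z FZ <-].
    by have [YZ|ZY] := Ftot _ _ FY FZ; [left|right]; apply: setSU.
exists (X `|` A0); split=> // B XB PB.
have PB' : P (B `|` A0).
  by rewrite (setUidl _)// => x A0x; apply: XB; right.
apply: contrapT => nBX; apply: (maxX B) => //; split.
  by move=> x Xx; apply: XB; left.
by move=> BX; apply: nBX => x /BX; left.
Qed.

Definition embeds (T U : Type) : Prop := exists f : T -> U, injective f.

Lemma embedsP (T U : Type) : ([set: T] #<= [set: U]) <-> embeds T U.
Proof.
split=> [/card_leP[f]|[f finj]].
  pose s (x : T) : [set: T] := SigSub (mem_set (I : [set: T] x)).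
  exists (fun x => val (f (s x))) => x y /val_inj /(@inj _ _ _ f).
  by move=> /(_ (mem_set I) (mem_set I)) /(congr1 val).
have /injfunPex[g] : exists2 f : T -> U, set_fun setT setT f & set_inj setT f.
  by exists f => // x y _ _; exact: finj.
exact: inj_card_le g.
Qed.

Lemma embeds_trans (U T V : Type) : embeds T U -> embeds U V -> embeds T V.
Proof. by move=> [f fI] [g gI]; exists (g \o f); exact: inj_comp. Qed.

Lemma embeds_surj (T U : Type) (f : T -> U) :
  (forall u, exists t, f t = u) -> embeds U T.
Proof.
move=> /choice[g gK]; exists g; exact: can_inj gK.
Qed.

Lemma embeds_prod (T U T' U' : Type) :
  embeds T T' -> embeds U U' -> embeds (T * U) (T' * U').
Proof.
move=> [f fI] [g gI]; exists (fun p => (f p.1, g p.2)).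
by move=> [a b] [c d] [] /fI -> /gI ->.
Qed.

(** A maximal partial injection from T to U, viewed as a subset of T * U, is
    total or onto: otherwise a pair of missed points could be added. *)
Lemma embeds_total (T U : Type) : embeds T U \/ embeds U T.
Proof.
pose good (G : set (T * U)) := (forall t u u', G (t, u) -> G (t, u') -> u = u')
  /\ (forall t t' u, G (t, u) -> G (t', u) -> t = t').
have [||G [_ [Gf Gi] Gmax]] := @Zorn_above _ good set0.
- by [].
- move=> F _ FP Ftot.
  have pair x y : (\bigcup_(X in F) X) x -> (\bigcup_(X in F) X) y ->
      exists X, [/\ F X, X x & X y].
    move=> [X FX Xx] [Y FY Yy].
    by have [XY|YX] := Ftot _ _ FX FY; [exists Y|exists X]; split=> //;
      [exact: XY|exact: YX].
  split=> [t u u' a b|t t' u a b]; have [X [/FP[Xf Xi] Xx Xy]] := pair _ _ a b.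
    exact: Xf Xx Xy.
  exact: Xi Xx Xy.
have [/choice[f fG]|] := pselect (forall t, exists u, G (t, u)).
  by left; exists f => t t' E; apply: (Gi t t' (f t)); rewrite // E.
move=> /existsNP[t0 nt0].
have [/choice[f fG]|] := pselect (forall u, exists t, G (t, u)).
  by right; exists f => u u' E; apply: (Gf (f u) u u'); rewrite // E.
move=> /existsNP[u0 nu0]; exfalso.
apply: (nt0); exists u0; apply: (Gmax (G `|` [set (t0, u0)])).
- exact: subsetUl.
- split=> [t u u' [a|[-> ->]] [b|[]]|t t' u [a|[-> ->]] [b|[]]] //.
  + exact: Gf a b.
  + by move=> E ?; case: nt0; exists u; rewrite -E.
  + by case: nt0; exists u'.
  + exact: Gi a b.
  + by move=> ? E; case: nu0; exists t; rewrite -E.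
  + by case: nu0; exists t'.
- by right.
Qed.

Lemma embeds_set_total (X : Type) (A B : set X) :
  (exists f : X -> X, (forall a, A a -> B (f a)) /\
     forall a a', A a -> A a' -> f a = f a' -> a = a') \/
  (exists f : X -> X, (forall b, B b -> A (f b)) /\
     forall b b', B b -> B b' -> f b = f b' -> b = b').
Proof.
have ext (A' B' : set X) : embeds {x | A' x} {x | B' x} ->
    exists f : X -> X, (forall a, A' a -> B' (f a)) /\
     forall a a', A' a -> A' a' -> f a = f a' -> a = a'.
  move=> [f fI].
  exists (fun x => if pselect (A' x) is left Ax
                   then proj1_sig (f (exist _ x Ax)) else x).
  split=> [a Aa|a a' Aa Aa'].
    by case: pselect => // Ax; exact: proj2_sig.
  case: pselect => // Ax; case: pselect => // Ax' E.
  have /fI[] : f (exist _ a Ax) = f (exist _ a' Ax') by exact: eq_sig_hprop.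
  by [].
by have [/ext|/ext] := embeds_total {x | A x} {x | B x}; [left|right].
Qed.

(** Hessenberg's theorem.  Take a maximal injection A * A -> A with A a subset of
    X containing a countable set.  If the complement of A embeds in A, then X
    embeds in A and X * X in A * A.  Otherwise A embeds in its complement by some
    u, and the injection extends to the square of the union of A and u A by
    sending all new pairs into u A. *)
Lemma embeds_square (X : Type) : embeds nat X -> embeds (X * X) X.
Proof.
move=> [n0 n0I].
(* The injections are represented by their graphs; A is dom G. *)
pose dom (G : set ((X * X) * X)) a := exists c, G ((a, a), c).
pose good G := [/\ forall a b, dom G a -> dom G b -> exists c, G ((a, b), c),
   forall p c c', G (p, c) -> G (p, c') -> c = c',
   forall p p' c, G (p, c) -> G (p', c) -> p = p' &
   forall a b c, G ((a, b), c) -> [/\ dom G a, dom G b & dom G c]].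
have [k kI] : embeds (nat * nat) nat by exists pickle; exact: pcan_inj pickleK.
pose G0 : set ((X * X) * X) :=
  [set p | exists i j, p = ((n0 i, n0 j), n0 (k (i, j)))].
have dom0 a : dom G0 a <-> exists i, a = n0 i.
  split=> [[c [i [j [-> _ _]]]]|[i ->]]; first by exists i.
  by exists (n0 (k (i, i))), i, i.
have [||G [G0G [Gt Gf Gi Gc] Gmax]] := @Zorn_above _ good G0.
- split.
  + by move=> a b /dom0[i ->] /dom0[j ->]; exists (n0 (k (i, j))), i, j.
  + move=> p c c' [i [j [-> ->]]] [i' [j' [/n0I <- /n0I <- ->]]] //.
  + move=> p p' c [i [j [-> ->]]] [i' [j' [-> /n0I/kI[<- <-]]]] //.
  + move=> a b c [i [j [-> -> ->]]].
    by split; apply/dom0; [exists i|exists j|exists (k (i, j))].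
- move=> F _ FP Ftot; set U := \bigcup_(X in F) X.
  have sub Y : F Y -> Y `<=` U by move=> FY y Yy; exists Y.
  have pair x y : U x -> U y -> exists X, [/\ F X, X x & X y].
    move=> [Y FY Yx] [Z FZ Zy].
    by have [YZ|ZY] := Ftot _ _ FY FZ; [exists Z|exists Y]; split=> //;
      [exact: YZ|exact: ZY].
  split.
  + move=> a b [c Uc] [c' Uc']; have [Y [FY Yc Yc']] := pair _ _ Uc Uc'.
    have [Yt _ _ _] := FP _ FY.
    have [||e Ye] := Yt a b; first by exists c.
      by exists c'.
    by exists e; exact: sub Ye.
  + move=> p c c' a b; have [Y [/FP[_ Yf _ _] ? ?]] := pair _ _ a b.
    by apply: Yf; eassumption.
  + move=> p c c' a b; have [Y [/FP[_ _ Yi _] ? ?]] := pair _ _ a b.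
    by apply: Yi; eassumption.
  + move=> a b c [Y FY Yc]; have [_ _ _ /(_ _ _ _ Yc)] := FP _ FY.
    by move=> [[e ?] [f ?] [g ?]]; split; [exists e|exists f|exists g];
       apply: sub; eassumption.
pose A := dom G.
have A0 i : A (n0 i) by exists (n0 (k (i, i))); apply: G0G; exists i, i.
have [e eG] : exists e : X -> X -> X,
    forall a b, A a -> A b -> G ((a, b), e a b).
  have /choice[e eG] : forall p : X * X, exists c, A p.1 -> A p.2 -> G (p, c).
    move=> [a b]; have [[Aa Ab]|nAB] := pselect (A a /\ A b).
      by have [c Gab] := Gt _ _ Aa Ab; exists c.
    by exists a => Aa Ab; case: nAB.
  by exists (fun a b => e (a, b)) => a b; exact: eG (a, b).
have eA a b : A a -> A b -> A (e a b).
  by move=> Aa Ab; have [] := Gc _ _ _ (eG _ _ Aa Ab).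
have eI a b a' b' : A a -> A b -> A a' -> A b' ->
    e a b = e a' b' -> a = a' /\ b = b'.
  move=> Aa Ab Aa' Ab' E; have := eG _ _ Aa Ab; rewrite E => G1.
  by have [] := Gi _ _ _ G1 (eG _ _ Aa' Ab').
(* fl tags the elements of two copies of A inside A. *)
pose fl (b : bool) := n0 b.
have Afl b : A (fl b) by exact: A0.
have flI : injective fl by case; case=> // /n0I.
have [[f [fA fI]]|[u [uA uI]]] := embeds_set_total (~` A) A.
  have /choice[g gP] : forall x, exists a, A a /\
      exists b, if b then x = a else ~ A x /\ f x = a.
    move=> x; have [Ax|nAx] := pselect (A x).
      by exists x; split=> //; exists true.
    by exists (f x); split; [exact: fA|exists false].
  have gA x : A (g x) by have [] := gP x.
  have /choice[t tP] : forall x, exists b, if b then x = g x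
     else ~ A x /\ f x = g x by move=> x; have [] := gP x.
  pose h x := e (fl (t x)) (g x).
  have hA x : A (h x) by exact: eA.
  have hI : injective h.
    move=> x y /(eI _ _ _ _ (Afl _) (gA _) (Afl _) (gA _))[/flI Et Eg].
    move: (tP x) (tP y); rewrite Et; case: (t y); first by rewrite Eg => -> <-.
    by rewrite Eg => -[nx <-] [ny /esym]; exact: fI.
  exists (fun p => e (h p.1) (h p.2)) => -[a b] [c d] /=.
  by move=> /(eI _ _ _ _ (hA _) (hA _) (hA _) (hA _))[/hI-> /hI->].
exfalso.
(* v enumerates A and u A by bool * A, and w is the injection on new pairs. *)
pose v (b : bool) a := if b then a else u a.
have vA b a : A a -> A (v b a) -> b by case: b => //= Aa /(uA _ Aa).
have vI b b' a a' : A a -> A a' -> v b a = v b' a' -> b = b' /\ a = a'.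
  move=> Aa Aa'; case: b; case: b' => //=.
  + by move=> E; case: (uA _ Aa'); rewrite -E.
  + by move=> E; case: (uA _ Aa); rewrite E.
  + by move=> /uI->.
pose w b b' a a' := u (e (e (fl b) (fl b')) (e a a')).
pose H : set ((X * X) * X) := [set p | exists b b' a a',
   [/\ A a, A a', ~~ (b && b') & p = ((v b a, v b' a'), w b b' a a')]].
have wA b b' a a' : A a -> A a' -> A (e (e (fl b) (fl b')) (e a a')).
  by move=> Aa Aa'; exact: (eA _ _ (eA _ _ (Afl b) (Afl b')) (eA _ _ Aa Aa')).
have Hu p c : H (p, c) -> ~ A c.
  by move=> [b [b' [a [a' [Aa Aa' _ [_ ->]]]]]]; apply: uA; exact: wA.
have HG p c c' : H (p, c) -> ~ G (p, c').
  move=> [b [b' [a [a' [Aa Aa' bb' [-> _]]]]]] /Gc[/(vA _ _ Aa) + /(vA _ _ Aa') + _].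
  by move: bb'; rewrite negb_and => /orP[/negbTE->|/negbTE->].
have domGH x : dom (G `|` H) x <-> exists b a, A a /\ x = v b a.
  split=> [[c [Gx|[b [b' [a [a' [Aa _ _ [-> _ _]]]]]]]]|[b [a [Aa ->]]]].
  - by exists true, x; split=> //; exists c.
  - by exists b, a.
  - case: b; first by have [c Gc'] := Aa; exists c; left.
    by exists (w false false a a); right; exists false, false, a, a.
apply: (uA (n0 0)) => //.
suff [GHt GHf GHi GHc] : good (G `|` H).
  have : dom (G `|` H) (u (n0 0)) by apply/domGH; exists false, (n0 0).
  by move=> [c] /(Gmax (G `|` H) (@subsetUl _ _ _)) Gu; exists c; exact: Gu.
split.
- move=> x y /domGH[b [a [Aa ->]]] /domGH[b' [a' [Aa' ->]]].
  have [/andP[-> ->]|nbb] := boolP (b && b').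
    by exists (e a a'); left; exact: eG.
  by exists (w b b' a a'); right; exists b, b', a, a'.
- move=> p c c' [Gp|Hp] [Gp'|Hp'].
  + exact: Gf Gp Gp'.
  + by case: (HG _ _ _ Hp' Gp).
  + by case: (HG _ _ _ Hp Gp').
  + move: Hp Hp' => [b [b' [a [a' [Aa Aa' _ [-> ->]]]]]].
    move=> [b1 [b1' [a1 [a1' [Aa1 Aa1' _ [+ + ->]]]]]].
    by move=> /(vI _ _ _ _ Aa Aa1)[-> ->] /(vI _ _ _ _ Aa' Aa1')[-> ->].
- move=> p p' c [Gp|Hp] [Gp'|Hp'].
  + exact: Gi Gp Gp'.
  + by case: (Hu _ _ Hp'); case: p Gp => x y /Gc[].
  + by case: (Hu _ _ Hp); case: p' Gp' => x y /Gc[].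
  + move: Hp Hp' => [b [b' [a [a' [Aa Aa' _ [-> ->]]]]]].
    move=> [b1 [b1' [a1 [a1' [Aa1 Aa1' _ [-> ]]]]]].
    move=> /(uI _ _ (wA _ _ _ _ Aa Aa') (wA _ _ _ _ Aa1 Aa1')).
    have e1 x x' : A (e (fl x) (fl x')) by apply: eA.
    move=> /(eI _ _ _ _ (e1 _ _) (eA _ _ Aa Aa') (e1 _ _) (eA _ _ Aa1 Aa1')).
    move=> [/(eI _ _ _ _ (Afl _) (Afl _) (Afl _) (Afl _))[/flI-> /flI->]].
    by move=> /(eI _ _ _ _ Aa Aa' Aa1 Aa1')[-> ->].
- move=> a b c [/Gc[? ? ?]|[x [x' [y [y' [Ay Ay' _ [-> -> ->]]]]]]].
    by split; apply/domGH; [exists true, a|exists true, b|exists true, c].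
  split; apply/domGH; [by exists x, y|by exists x', y'|].
  by exists false, (e (e (fl x) (fl x')) (e y y')); split=> //; exact: wA.
Qed.

Lemma embeds_mul (X T U : Type) :
  embeds nat X -> embeds T X -> embeds U X -> embeds (T * U) X.
Proof.
move=> Xinf TX UX; apply: embeds_trans (embeds_square Xinf).
exact: embeds_prod.
Qed.

(** A sequence is determined by its size and by the iterated pairing of its
    entries. *)
Lemma embeds_seq (X T : Type) : embeds nat X -> embeds T X -> embeds (seq T) X.
Proof.
move=> Xinf [f fI]; have [e eI] := embeds_square Xinf.
have [n0 n0I] := Xinf.
pose c := fix c s := if s is x :: s' then e (f x, c s') else n0 0.
exists (fun s => e (n0 (size s), c s)) => s t /eI[/n0I].
elim: s t => [|x s IH] [|y t] //= [/IH st] /eI[/fI-> /st->] //.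
Qed.

Lemma embeds_sum (X T U : Type) :
  embeds nat X -> embeds T X -> embeds U X -> embeds (T + U) X.
Proof.
move=> Xinf [f fI] [g gI]; apply: (@embeds_trans (bool * X)).
  exists (fun p => match p with inl t => (true, f t) | inr u => (false, g u) end).
  by case=> [t|u] [t'|u'] // [] => [/fI ->|/gI ->].
apply: embeds_mul => //; last by exists id.
by apply: embeds_trans Xinf; exists nat_of_bool; case; case.
Qed.

Lemma embeds_tree (X T : Type) :
  embeds nat X -> embeds T X -> embeds (GenTree.tree T) X.
Proof.
move=> Xinf TX; apply: (@embeds_trans (seq (nat + T))).
  exists (@GenTree.encode T); exact: pcan_inj (@GenTree.codeK T).
by apply: embeds_seq => //; exact: embeds_sum.
Qed.

Section SuccCardinal.
Context (K : Type) (d : Order.disp_t) (kappa : orderType d).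
Hypothesis Kinf : embeds nat K.
Hypothesis kappaE : is_succ_cardinal K kappa.

Lemma succ_cardinal_embeds : embeds K kappa.
Proof.
have [_ /negP nK _] := kappaE.
have [//|/embedsP] := embeds_total K kappa; exact: contraPP.
Qed.

(** Regularity of the successor cardinal: if f were unbounded, each i in kappa
    would be given by some x with i <= f x together with the position of i below
    f x, so that kappa would embed in X * (bool * K), hence in K. *)
Lemma succ_cardinal_bounded (X : Type) (f : X -> kappa) :
  embeds X K -> exists i, forall x, (f x < i)%O.
Proof.
move=> XK; apply: contrapT => nb.
have /choice[x xP] i : exists x, (i <= f x)%O.
  apply: contrapT => ni; apply: nb; exists i => x.
  by rewrite Order.TotalTheory.ltNge; apply/negP => fi; apply: (ni); exists x.
have [_ /negP nK segK] := kappaE; apply: nK; apply/embedsP.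
have /choice[e eI] i : exists e : kappa -> K, forall j k,
    (j < i)%O -> (k < i)%O -> e j = e k -> j = k.
  have /embedsP[g gI] : [set: [set j | (j < i)%O]] #<= [set: K].
    by rewrite (card_le_eql (card_setT _)); exact: segK.
  have [n0 _] := Kinf.
  exists (fun j => if pselect ((j < i)%O) is left ji
    then g (SigSub (mem_set (ji : [set j | (j < i)%O] j))) else n0 0) => j k ji ki.
  by case: pselect => // ?; case: pselect => // ? /gI /(congr1 val).
apply: (@embeds_trans (X * (bool * K))).
  (* The boolean separates i < f x from i = f x. *)
  exists (fun i => (x i, ((i < f (x i))%O, e (f (x i)) i))) => i j [E].
  rewrite -E => Eb Ee; have := xP i; have := xP j; rewrite -E.
  rewrite !Order.POrderTheory.le_eqVlt -Eb.
  case: (Order.TotalTheory.ltP i (f (x i))) Eb Ee => [ij Eb Ee _ _|_ _ _].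
    by apply: (eI _ _ _ ij) Ee; rewrite -Eb.
  by rewrite !orbF => /eqP -> /eqP.
do ![apply: embeds_mul => //]; last by exists id.
by apply: embeds_trans Kinf; exists nat_of_bool; case; case.
Qed.

End SuccCardinal.

Lemma limit_ordinal_succ d (I : orderType d) (i : I) :
  is_limit_ordinal I -> exists j, is_succ i j.
Proof.
move=> [wf _ /(_ i)[j ij]].
elim: (wf j) ij => {}j _ IH ij.
have [[k /andP[ik kj]]|nk] := pselect (exists k, (i < k < j)%O).
  exact: IH kj ik.
by exists j; split=> // k ikj; apply: nk; exists k.
Qed.

Local Open Scope ring_scope.

(** * Matrices acting on families, and the equational criterion for flatness *)

Section Action.
Context (R : pzRingType) (M : lmodType R).

(** Systems of linear equations with unknowns w are written act B w = v
    throughout. *)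
Definition act m n (A : 'M[R]_(m, n)) (v : 'I_n -> M) : 'I_m -> M :=
  fun j => \sum_i A j i *: v i.

Lemma actD m n (A : 'M[R]_(m, n)) v w : act A (v + w) = act A v + act A w.
Proof.
apply/funext => j; rewrite -[RHS]/(act A v j + act A w j) -big_split /=.
by apply: eq_bigr => i _; rewrite scalerDr.
Qed.

Lemma act0 m n (A : 'M[R]_(m, n)) : act A 0 = 0.
Proof. by apply/funext => j; rewrite /act big1 // => i _; rewrite scaler0. Qed.

Lemma actN m n (A : 'M[R]_(m, n)) v : act A (- v) = - act A v.
Proof.
apply/funext => j; rewrite -[RHS]/(- act A v j) -sumrN /=.
by apply: eq_bigr => i _; rewrite scalerN.
Qed.

Lemma actB m n (A : 'M[R]_(m, n)) v w : act A (v - w) = act A v - act A w.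
Proof. by rewrite actD actN. Qed.

Lemma act1 m (v : 'I_m -> M) : act 1%:M v = v.
Proof.
apply/funext => j; rewrite /act (bigD1 j) //= mxE eqxx scale1r big1 ?addr0 //.
by move=> i ij; rewrite mxE eq_sym (negbTE ij) scale0r.
Qed.

Lemma act0m m n (v : 'I_n -> M) : act (0 : 'M[R]_(m, n)) v = 0.
Proof. by apply/funext => j; rewrite /act big1 // => i _; rewrite mxE scale0r. Qed.

Definition vcat m n (v : 'I_m -> M) (w : 'I_n -> M) : 'I_(m + n) -> M :=
  fun i => match fintype.split i with inl k => v k | inr k => w k end.

Lemma vcatl m n (v : 'I_m -> M) (w : 'I_n -> M) i : vcat v w (lshift n i) = v i.
Proof. by rewrite /vcat (unsplitK (inl i)). Qed.

Lemma vcatr m n (v : 'I_m -> M) (w : 'I_n -> M) i : vcat v w (rshift m i) = w i.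
Proof. by rewrite /vcat (unsplitK (inr i)). Qed.

Lemma act_row_mx m n p (A : 'M[R]_(m, n)) (B : 'M[R]_(m, p)) v w :
  act (row_mx A B) (vcat v w) = act A v + act B w.
Proof.
apply/funext => j; rewrite -[RHS]/(act A v j + act B w j) /act big_split_ord /=.
congr (_ + _); apply: eq_bigr => i _.
  by rewrite row_mxEl vcatl.
by rewrite row_mxEr vcatr.
Qed.

End Action.

Lemma act_map (R : pzRingType) (M N : lmodType R) (f : {linear M -> N}) m n
    (A : 'M[R]_(m, n)) v : act A (f \o v) = f \o act A v.
Proof.
apply/funext => j; rewrite /act /= linear_sum.
by apply: eq_bigr => i _; rewrite linearZ.
Qed.

(** The equational criterion for flatness: a relation between elements of M holds
    for a reason visible in R. *)
Definition flat_eq (R : pzRingType) (M : lmodType R) : Prop :=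
  forall p n (A : 'M[R]_(p, n)) (m : 'I_n -> M), act A m = 0 ->
    exists q (C : 'M[R]_(n, q)) (z : 'I_q -> M), m = act C z /\ A *m C = 0.

Section Zlift.
Context (T : zmodType) (K : choiceType).

(** The module zmodule T is T with the action of int by multiples; it turns the
    lifting of functions to linear maps into a lifting to group morphisms. *)
Definition zlift (f : K -> T) (x : {freeg K / int}) : T :=
  @fglift int (zmodule T) K f x.

Lemma zliftB f : zmod_morphism (zlift f).
Proof. exact: (@lift_is_additive int K (zmodule T) f). Qed.

Lemma zliftU f k : zlift f << k >> = f k.
Proof. by rewrite /zlift liftU scale1r. Qed.

Lemma freeg_ext (f g : {freeg K / int} -> T) x :
  zmod_morphism f -> zmod_morphism g ->
  (forall k, k \in dom x -> f << k >> = g << k >>) -> f x = g x.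
Proof.
move=> fB gB fg.
have add (h : {freeg K / int} -> T) : zmod_morphism h ->
    exists h' : {additive {freeg K / int} -> T}, h' =1 h.
  move=> hB; pose hA := GRing.isZmodMorphism.Build _ _ h hB.
  by exists (HB.pack h hA : {additive {freeg K / int} -> T}).
have [f' f'E] := add f fB; have [g' g'E] := add g gB.
rewrite -f'E -g'E -(freeg_sumE x) !raddf_sum !big_seq /=.
apply: eq_bigr => k kx.
by rewrite -[coeff k x]intz -freegU_mulz !raddfMz /= f'E g'E fg.
Qed.

End Zlift.

Section Additive.
Context (U V : zmodType) (f : U -> V).
Hypothesis fB : zmod_morphism f.

Lemma zmorph0 : f 0 = 0.
Proof. by rewrite -[X in f X](subrr 0) fB subrr. Qed.

Lemma zmorphN x : f (- x) = - f x.
Proof. by rewrite -[X in f X]sub0r fB zmorph0 sub0r. Qed.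

Lemma zmorphD x y : f (x + y) = f x + f y.
Proof. by rewrite -[X in f (x + X)]opprK fB zmorphN opprK. Qed.

Lemma zmorph_sum I (s : seq I) (F : I -> U) :
  f (\sum_(i <- s) F i) = \sum_(i <- s) f (F i).
Proof. exact: (big_morph f zmorphD zmorph0). Qed.

End Additive.

Section Tens.
Context (R : pzRingType) (M : lmodType R) (A : lmodType R^c).

Lemma tensDl (m : M) : {morph (fun a : A => tens a m) : a b / a + b}.
Proof.
move=> a b; rewrite /tens -(zmorphD (@tensor_class_additive _ M A)).
by apply/tensor_classP; rewrite opprD addrA; exact: tensor_nullDl.
Qed.

Lemma tensDr (a : A) : {morph (fun m : M => tens a m) : m n / m + n}.
Proof.
move=> m n; rewrite /tens -(zmorphD (@tensor_class_additive _ M A)).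
by apply/tensor_classP; rewrite opprD addrA; exact: tensor_nullDr.
Qed.

Lemma tensZ (r : R) (a : A) (m : M) : tens ((r : R^c) *: a) m = tens a (r *: m).
Proof. by apply/tensor_classP; exact: tensor_nullZ. Qed.

Lemma tens0l (m : M) : tens (0 : A) m = 0.
Proof. by apply: (addrI (tens (0 : A) m)); rewrite -tensDl !addr0. Qed.

Lemma tens0r (a : A) : tens a (0 : M) = 0.
Proof. by apply: (addrI (tens a (0 : M))); rewrite -tensDr !addr0. Qed.

Lemma tens_sumr (a : A) I (s : seq I) (F : I -> M) :
  tens a (\sum_(i <- s) F i) = \sum_(i <- s) tens a (F i).
Proof. exact: (big_morph _ (tensDr a) (tens0r a)). Qed.

Lemma tens_suml (m : M) I (s : seq I) (F : I -> A) :
  tens (\sum_(i <- s) F i) m = \sum_(i <- s) tens (F i) m.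
Proof. exact: (big_morph _ (tensDl m) (tens0l m)). Qed.

End Tens.

(** A list rho of pairs (r, m) stands for a formal linear combination; it is a
    relation of M when relsum rho id = 0, and relsum rho g = 0 says that g
    respects it. *)
Definition relsum (R : pzRingType) (M N : lmodType R) (rho : seq (R * M))
  (g : M -> N) : N := \sum_(p <- rho) p.1 *: g p.2.

Lemma relsum_index (R : pzRingType) (M N : lmodType R) (s : seq M) (g : M -> N)
    (rho : seq (R * M)) :
  uniq s -> {subset map snd rho <= s} ->
  relsum rho g =
  \sum_(i < size s) (\sum_(p <- rho | p.2 == s`_i) p.1) *: g s`_i.
Proof.
move=> us rs; under eq_bigr do rewrite scaler_suml big_mkcond.
rewrite exchange_big /= /relsum !big_seq; apply: eq_bigr => p prho.
have ps : p.2 \in s by apply: rs; apply: map_f.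
have pi : (index p.2 s < size s)%N by rewrite index_mem.
rewrite (bigD1 (Ordinal pi)) //= nth_index // eqxx big1 ?addr0 //.
by move=> i /negP nE; case: eqP => // E; case: nE; rewrite -val_eqE /= E index_uniq.
Qed.

(** Coefficients can be chosen as functions C k on the whole of M which expand the
    elements of a finite list and respect finitely many prescribed relations, as
    if each C k were linear.  This is the matrix form of the criterion applied to
    the list of all elements that occur. *)
Lemma flat_eq_lift (R : pzRingType) (M : lmodType R) (T : seq (seq (R * M)))
    (S : seq M) :
  flat_eq M -> (forall rho, rho \in T -> relsum rho id = 0) ->
  exists q (C : 'I_q -> M -> R) (z : 'I_q -> M),
    (forall m, m \in S -> m = \sum_k C k m *: z k) /\
    forall k rho, rho \in T -> relsum rho (C k : M -> R^o) = 0.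
Proof.
move=> flatM T0; pose s := undup (S ++ map snd (flatten T)).
have us : uniq s by exact: undup_uniq.
have Ss m : m \in S -> m \in s by rewrite mem_undup mem_cat => ->.
have Ts rho : rho \in T -> {subset map snd rho <= s}.
  move=> rT _ /mapP[p pr ->]; rewrite mem_undup mem_cat map_f ?orbT //.
  by apply/flattenP; exists rho.
pose A := \matrix_(j < size T, i < size s)
  \sum_(p <- nth [::] T j | p.2 == s`_i) p.1.
have [|q [C [z [zE AC]]]] := flatM _ _ A (fun i => s`_i).
  apply/funext => j; have jT : nth [::] T j \in T by exact: mem_nth.
  rewrite -[RHS](T0 _ jT) (@relsum_index _ _ _ s _ _ us (Ts _ jT)).
  by apply: eq_bigr => i _; rewrite mxE.
pose c k (m : M) : R := if insub (index m s) is Some i then C i k else 0.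
have cE k (i : 'I_(size s)) : c k s`_i = C i k.
  rewrite /c index_uniq //; case: insubP => [j _ /val_inj -> //|].
  by rewrite ltn_ord.
exists q, c, z; split=> [m /Ss ms|k rho rT].
  have mi : (index m s < size s)%N by rewrite index_mem.
  have -> : m = s`_(Ordinal mi) by rewrite /= nth_index.
  rewrite [LHS](congr1 (@^~ (Ordinal mi)) zE) /act.
  by apply: eq_bigr => k _; rewrite cE.
rewrite (@relsum_index _ _ _ s _ _ us (Ts _ rT)).
have jT : (index rho T < size T)%N by rewrite index_mem.
have /matrixP/(_ (Ordinal jT) k) := AC; rewrite !mxE => E.
by apply: etrans E; apply: eq_bigr => i _; rewrite cE mxE /= nth_index.
Qed.

(** The tensor relations needed to show that a formal sum x vanishes involve only
    finitely many relations of M.  Hence x null implies that e C x vanishes for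
    every coefficient function C respecting these relations, where e C maps
    (a, m) to a (C m).  For a null image of x in B this yields e C x = 0 already
    in A, f being injective; with C as in flat_eq_lift, x is equal to the sum of
    the tensors of e (C k) x and z k, which vanishes. *)
Lemma flat_of_flat_eq (R : pzRingType) (M : lmodType R) : flat_eq M -> flat M.
Proof.
move=> flatM A B f fI; have fB := @tensor_map_additive _ M _ _ f.
suff ker t : tensor_map M f t = 0 -> t = 0.
  move=> t u E; apply/eqP; rewrite -subr_eq0; apply/eqP/ker.
  by rewrite fB E subrr.
pose x := tensor_repr t.
have -> : t = tensor_class x by rewrite /x /tensor_class /tensor_repr reprK.
pose F := fglift (fun k : A * M => << (f k.1, k.2) >> : {freeg (B * M) / int}).
have FB : zmod_morphism F by exact: lift_is_additive.
pose e (X : lmodType R^c) (C : M -> R) : {freeg (X * M) / int} -> X :=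
  zlift (fun k : X * M => (C k.2 : R^c) *: k.1).
have eB X C : zmod_morphism (@e X C) by exact: zliftB.
rewrite tensor_map_class -(zmorph0 (@tensor_class_additive _ M B)).
move=> /tensor_classP; rewrite subr0 -/(F x) => Fx0.
have {Fx0}[T [T0 Te]] : exists T : seq (seq (R * M)),
    (forall rho, rho \in T -> relsum rho id = 0) /\
    forall C : M -> R, (forall rho, rho \in T -> relsum rho (C : M -> R^o) = 0) ->
      e B C (F x) = 0.
  move: (F x) Fx0 => w w0; elim: w / w0 =>
    [|y z _ [Ty [Ty0 Tye]] _ [Tz [Tz0 Tze]]|a b m|a m n|r a m].
  - by exists [::]; split=> // C _; exact: zmorph0 (eB _ _).
  - exists (Ty ++ Tz); split=> [rho|C CT].
      by rewrite mem_cat => /orP[/Ty0|/Tz0].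
    rewrite eB Tye ?Tze ?subrr // => rho rT; apply: CT;
      by rewrite mem_cat rT ?orbT.
  - exists [::]; split=> // C _.
    by rewrite !eB /e !zliftU scalerDr addrAC addrK subrr.
  - exists [:: [:: (1, m + n); (-1, m); (-1, n)]]; split=> [rho|C].
      rewrite inE => /eqP ->; rewrite /relsum !big_cons big_nil /=.
      by rewrite addr0 scale1r !scaleN1r -opprD subrr.
    move=> /(_ _ (mem_head _ _)); rewrite /relsum !big_cons big_nil /=.
    rewrite addr0 scale1r !scaleN1r -opprD => /subr0_eq E.
    by rewrite !eB /e !zliftU /= E scalerDl addrAC addrK subrr.
  - exists [:: [:: (1, r *: m); (- r, m)]]; split=> [rho|C].
      rewrite inE => /eqP ->; rewrite /relsum !big_cons big_nil /=.
      by rewrite addr0 scale1r scaleNr subrr.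
    move=> /(_ _ (mem_head _ _)); rewrite /relsum !big_cons big_nil /=.
    rewrite addr0 scale1r scaleNr => /subr0_eq E.
    by rewrite !eB /e !zliftU /= E scalerA subrr.
have [q [C [z [Cz CT]]]] := flat_eq_lift (map snd (dom x)) flatM T0.
have ex k : e A (C k) x = 0.
  apply: fI; rewrite linear0 -[RHS](Te (C k)); last by move=> rho; exact: CT.
  apply: (@freeg_ext _ _ (f \o e A (C k)) (e B (C k) \o F)) => [u v|u v|a _] /=.
  - by rewrite eB linearB.
  - by rewrite FB eB.
  - by rewrite /F liftU scale1r /e !zliftU /= linearZ.
transitivity (\sum_k tens (e A (C k) x) (z k)); last first.
  by rewrite big1 // => k _; rewrite ex tens0l.
apply: (@freeg_ext _ _ _ (fun x => \sum_k tens (e A (C k) x) (z k))).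
- exact: tensor_class_additive.
- move=> u v; rewrite -sumrB; apply: eq_bigr => k _.
  rewrite eB; apply: (addIr (tens (e A (C k) v) (z k))).
  by rewrite -tensDl !subrK.
- move=> [a m] am; rewrite -/(tens a m) {1}(Cz m); last exact: (map_f snd am).
  rewrite tens_sumr; apply: eq_bigr => k _.
  by rewrite -tensZ /e zliftU.
Qed.

(** * Submodules given by sets, and the converse criterion *)

Section Mksub.
Context (R : pzRingType) (M : lmodType R).

Definition is_submodule (P : set M) : Prop :=
  P 0 /\ forall a x y, P x -> P y -> P (a *: x + y).

Definition asbool_pred (P : set M) : {pred M} := fun x => `[< P x >].

Lemma is_submodule_closed P : is_submodule P -> submod_closed (asbool_pred P).
Proof.
move=> [P0 PL]; split=> [|a x y]; rewrite /asbool_pred !unfold_in.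
  exact/asboolP.
by move=> /asboolP Px /asboolP Py; apply/asboolP; exact: PL.
Qed.

Definition mksub P (subP : is_submodule P) : submodClosed M :=
  HB.pack (asbool_pred P)
    (GRing.isSubmodClosed.Build R M (asbool_pred P) (is_submodule_closed subP)).

Lemma mksubP P (subP : is_submodule P) x : x \in mksub subP <-> P x.
Proof. by split=> [/asboolP//|Px]; exact/asboolP. Qed.

Lemma mksubE P (subP : is_submodule P) : [set` mksub subP] = P.
Proof. by apply/seteqP; split=> x; [move/mksubP|move=> Px; apply/mksubP]. Qed.

Lemma submodClosed_is_submodule (S : submodClosed M) : is_submodule [set` S].
Proof.
split=> [|a x y Sx Sy]; first exact: rpred0.
by apply: rpredD => //; exact: rpredZ.
Qed.

Lemma is_submodD P x y : is_submodule P -> P x -> P y -> P (x + y).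
Proof. by move=> [_ PL] Px Py; rewrite -[x]scale1r; exact: PL. Qed.

Lemma is_submodZ P a x : is_submodule P -> P x -> P (a *: x).
Proof. by move=> [P0 PL] Px; rewrite -[_ *: _]addr0; exact: PL. Qed.

Lemma is_submodN P x : is_submodule P -> P x -> P (- x).
Proof. by move=> sP Px; rewrite -scaleN1r; exact: is_submodZ. Qed.

Lemma is_submodB P x y : is_submodule P -> P x -> P y -> P (x - y).
Proof. by move=> sP Px Py; apply: is_submodD => //; exact: is_submodN. Qed.

Lemma is_submod_act P m n (A : 'M[R]_(m, n)) v : is_submodule P ->
  (forall i, P (v i)) -> forall j, P (act A v j).
Proof.
move=> sP Pv j; apply: (big_ind P); first by case: sP.
  by move=> x y; exact: is_submodD.
by move=> i _; exact: is_submodZ.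
Qed.

End Mksub.

(** Let I be the right module of columns A a, with a in R^n, and let c j be the
    j-th column of A.  The sum x of the tensors of c j and m j vanishes in
    R^p (x) M because A m = 0, hence in I (x) M by flatness.  Choose a section
    s of R^n -> I.  The map sending (a, y) to s a y is bilinear up to families
    C z with A C = 0, so the image of x, the sum of the s (c j) (m j), is such a
    family.  Finally m differs from it by (1 - s c) m, and A (1 - s c) = 0. *)
Lemma flat_eq_of_flat (R : pzRingType) (M : lmodType R) : flat M -> flat_eq M.
Proof.
move=> flatM p n A m Am0.
pose V : lmodType R^c := ('I_p -> (R^c)^o).
pose col (a : 'I_n -> R) : V := fun i => \sum_j A i j * a j.
have colB a b : col (a - b) = col a - col b.
  apply/funext => i; rewrite -[RHS]/(col a i - col b i) /col -sumrB.
  by apply: eq_bigr => j _; exact: (mulrBr (A i j) (a j) (b j)).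
have subI : is_submodule (range col).
  split=> [|r x y [a _ <-] [b _ <-]].
    by exists 0 => //; apply/funext => i; rewrite /col big1 // => j _; rewrite mulr0.
  exists (fun j => a j * r + b j) => //; apply/funext => i.
  rewrite -[RHS]/((col a i : R) * (r : R) + (col b i : R)) /col mulr_suml -big_split /=.
  by apply: eq_bigr => j _; rewrite mulrDr mulrA.
pose I : lmodType R^c := submod (mksub subI).
have /choice[s sE] (x : I) : exists a, col a = val x.
  by have /mksubP[a _ E] := valP x; exists a.
pose K (v : 'I_n -> M) : Prop := exists q (C : 'M[R]_(n, q)) (z : 'I_q -> M),
  v = act C z /\ A *m C = 0.
have KD v w : K v -> K w -> K (v + w).
  move=> [q [C [z [-> AC]]]] [q' [C' [z' [-> AC']]]].
  exists (q + q')%N, (row_mx C C'), (vcat z z'); split.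
    by rewrite act_row_mx.
  by rewrite mul_mx_row AC AC' row_mx0.
have KN v : K v -> K (- v).
  by move=> [q [C [z [-> AC]]]]; exists q, C, (- z); rewrite actN.
have Kcol a (y : M) : col a = 0 -> K (fun j => a j *: y).
  move=> a0; exists 1%N, (\col_j a j), (fun=> y); split.
    by apply/funext => j; rewrite /act big_ord1 mxE.
  apply/matrixP => i k; rewrite !mxE -[RHS](congr1 (@^~ i) a0).
  by apply: eq_bigr => j _; rewrite mxE.
pose F : {freeg (I * M) / int} -> ('I_n -> M) :=
  zlift (fun k : I * M => (fun j => s k.1 j *: k.2) : 'I_n -> M).
have FB : zmod_morphism F by exact: zliftB.
have FU a y : F << (a, y) >> = fun j => s a j *: y by exact: zliftU.
have FK x : tensor_null x -> K (F x).
  elim=> {x} [|x y _ Kx _ Ky|a b y|a y z|r a y].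
  - rewrite (zmorph0 FB); exists 0%N, 0, (fun=> 0).
    by rewrite act0m mulmx0.
  - by rewrite FB; apply: KD => //; exact: KN.
  - rewrite !FB !FU.
    have /(Kcol _ y) : col (s (a + b) - s a - s b) = 0.
      by rewrite !colB !sE /= addrAC addrK subrr.
    congr K; apply/funext => j.
    by rewrite -[RHS]/(s (a + b) j *: y - s a j *: y - s b j *: y) -!scalerBl.
  - rewrite !FB !FU; have /(Kcol _ y) : col 0 = 0.
      by apply/funext => i; rewrite /col big1 // => j _; rewrite mulr0.
    congr K; apply/funext => j.
    rewrite -[RHS]/(s a j *: (y + z) - s a j *: y - s a j *: z) scalerDr.
    by rewrite addrAC addrK subrr scale0r.
  - rewrite FB !FU; pose t : 'I_n -> R := fun j => s a j * r.
    have /(Kcol _ y) : col (s ((r : R^c) *: a) - t) = 0.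
      have E : col t = (r : R^c) *: col (s a).
        apply/funext => i; rewrite -[RHS]/((col (s a) i : R) * (r : R)) /col mulr_suml.
        by apply: eq_bigr => j _; rewrite mulrA.
      by rewrite colB E !sE subrr.
    congr K; apply/funext => j.
    rewrite -[RHS]/(s ((r : R^c) *: a) j *: y - s a j *: (r *: y)) scalerA.
    by rewrite -scalerBl.
pose e j : 'I_n -> R := fun k => (k == j)%:R.
have cole j i : col (e j) i = A i j.
  rewrite /col (bigD1 j) //= /e eqxx mulr1 big1 ?addr0 // => k kj.
  by rewrite (negbTE kj) mulr0.
have colI j : col (e j) \in mksub subI by apply/mksubP; exists (e j).
pose c j : I := Sub (col (e j)) (colI j).
pose x := \sum_j << (c j, m j) >> : {freeg (I * M) / int}.
have x0 : tensor_null x.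
  rewrite -[x]subr0; apply/tensor_classP.
  pose f : {linear I -> V} := val.
  apply: (flatM _ _ f); first exact: val_inj.
  rewrite !(zmorph0 (@tensor_class_additive _ M I)) (zmorph0 (@tensor_map_additive _ M _ _ f)).
  rewrite (zmorph_sum (@tensor_class_additive _ M I)).
  rewrite (zmorph_sum (@tensor_map_additive _ M _ _ f)).
  pose d i : V := fun k => (k == i)%:R.
  transitivity (\sum_i tens (d i) (act A m i)); last first.
    by rewrite Am0 big1 // => i _; rewrite tens0r.
  under [RHS]eq_bigr do rewrite tens_sumr.
  rewrite exchange_big /=; apply: eq_bigr => j _.
  rewrite tensor_map_tens; under eq_bigr do rewrite -tensZ.
  rewrite -tens_suml; congr tens; apply/funext => k.
  transitivity (A k j); first exact: cole.
  rewrite fct_sumE (bigD1 k) //= big1 ?addr0 => [|i ik].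
    by rewrite -[RHS]/((k == k)%:R * A k j) eqxx mul1r.
  by rewrite -[LHS]/((k == i)%:R * A i j) eq_sym (negbTE ik) mul0r.
have -> : m = (m - F x) + F x by rewrite subrK.
apply: (KD _ _ _ (FK _ x0)).
exists n, (1%:M - \matrix_(i, j) s (c j) i), m; split.
  apply/funext => i; rewrite (zmorph_sum FB) /act.
  rewrite -[LHS]/(m i - (\sum_j F << (c j, m j) >>) i) fct_sumE.
  under [RHS]eq_bigr do rewrite mxE scalerDl.
  rewrite big_split /= -[X in _ = X + _]/(act 1%:M m i) act1 -sumrN.
  congr (_ + _); apply: eq_bigr => j _.
  by rewrite !mxE scaleNr FU.
rewrite mulmxBr mulmx1; apply/eqP; rewrite subr_eq0; apply/eqP/matrixP => i j.
rewrite mxE; under eq_bigr do rewrite mxE.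
by rewrite -[RHS]/(col (s (c j)) i) sE /= cole.
Qed.

(** * Purity, closure properties of flatness, quotient modules *)

Lemma flatP (R : pzRingType) (M : lmodType R) : flat M <-> flat_eq M.
Proof. by split; [exact: flat_eq_of_flat|exact: flat_of_flat_eq]. Qed.

Section Pure.
Context (R : pzRingType).

(** Purity for submodules P: a system B w = v with constants v in P that is
    solvable in Q is solvable in P.  The existentially quantified systems with
    coefficients on the parameters reduce to this form. *)
Definition pure (M : lmodType R) (P Q : set M) : Prop :=
  P `<=` Q /\ forall p q (B : 'M[R]_(p, q)) w, (forall k, Q (w k)) ->
    (forall j, P (act B w j)) ->
    exists w', (forall k, P (w' k)) /\ act B w' = act B w.

Lemma pure_subE (M : lmodType R) (P Q : set M) :
  is_submodule P -> pure_sub P Q <-> pure P Q.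
Proof.
move=> sP; split=> -[PQ H]; split=> //.
  (* The formula says that B w - v = 0, with parameters v := B w. *)
  move=> p q B w Qw Pw.
  have N1 : act (- 1%:M) (act B w) = - act B w.
    apply/funext => j; rewrite -[in RHS](act1 (act B w)).
    rewrite -[RHS]/(- act 1%:M (act B w) j) -sumrN; apply: eq_bigr => i _.
    by rewrite mxE scaleNr.
  have [_ []] := H p (PPFormula (- 1%:M) B) (act B w) Pw.
    exists w; split=> // j.
    by rewrite -[LHS]/((act (- 1%:M) (act B w) + act B w) j) N1 addNr.
  move=> w' /= [Pw' E]; exists w'; split=> //; apply/funext => j.
  have := E j; rewrite -[X in X = 0]/(act (- 1%:M) (act B w) j + act B w' j) N1.
  by move/eqP; rewrite addrC subr_eq0 => /eqP.
move=> n phi v Pv; split=> [[w [Pw E]]|[w [Qw E]]].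
  by exists w; split=> // k; exact: PQ.
have E' : act (pp_bound phi) w = - act (pp_free phi) v.
  by apply/funext => j; apply/eqP; rewrite -addr_eq0 addrC; exact/eqP/E.
have [|w' [Pw' wE]] := H _ _ (pp_bound phi) w Qw.
  by rewrite E' => j; apply: is_submodN => //; exact: is_submod_act.
exists w'; split=> // j; rewrite -[X in _ + X]/(act (pp_bound phi) w' j) wE.
exact: E.
Qed.

(** Purity of the image of f, pulled back to M. *)
Lemma pure_embeddingP (M N : lmodType R) (f : {linear M -> N}) :
  pure_embedding f <-> injective f /\
  forall p q (B : 'M[R]_(p, q)) w v, act B w = f \o v -> exists w', act B w' = v.
Proof.
have sf : is_submodule (range f).
  split=> [|a _ _ [x _ <-] [y _ <-]]; first by exists 0 => //; rewrite linear0.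
  by exists (a *: x + y) => //; rewrite linearP.
rewrite /pure_embedding pure_subE //.
split=> -[fI H]; split=> //.
  move=> p q B w v E; have [//|j|w' [fw' Bw']] := H.2 _ _ B w.
    by rewrite E; exists (v j).
  have /choice[w'' E''] k : exists x, f x = w' k.
    by have [x _ <-] := fw' k; exists x.
  exists w''; apply/funext => j; apply: fI.
  rewrite -[RHS]/((f \o v) j) -E -Bw' -[LHS]/((f \o act B w'') j) -act_map.
  by congr (act B _ j); apply/funext => k /=.
split=> // p q B w _ fBw.
have /choice[v vE] j : exists x, f x = act B w j.
  by have [x _ <-] := fBw j; exists x.
have [|w' E'] := H _ _ B w v.
  by apply/funext => j; rewrite /= vE.
exists (f \o w'); split=> [k|]; first by exists (w' k).
by rewrite act_map E'; apply/funext => j; exact: vE.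
Qed.

Lemma pure_embedding_comp (M N K : lmodType R) (f : {linear M -> N})
    (g : {linear N -> K}) (h : {linear M -> K}) :
  pure_embedding f -> pure_embedding g -> h =1 g \o f -> pure_embedding h.
Proof.
move=> /pure_embeddingP[fI fP] /pure_embeddingP[gI gP] hE.
apply/pure_embeddingP; split=> [x y|p q B w v E].
  by rewrite !hE => /gI/fI.
have [|w' E'] := gP _ _ B w (f \o v).
  by rewrite E; apply/funext => j /=; rewrite hE.
exact: fP E'.
Qed.

(** Elements z of N that explain a relation of M can be pulled back to M, as they
    solve the system m = C z with constants in M. *)
Lemma flat_pure_embedding (M N : lmodType R) (f : {linear M -> N}) :
  pure_embedding f -> flat N -> flat M.
Proof.
move=> /pure_embeddingP[fI fP] /flatP flatN; apply/flatP => p n A m Am0.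
have [|q [C [z [zE AC]]]] := flatN _ _ A (f \o m).
  by rewrite act_map Am0; apply/funext => j /=; rewrite linear0.
by have [z' zE'] := fP _ _ C z m (esym zE); exists q, C, z'.
Qed.

Lemma pure_submod (M : lmodType R) (S : submodClosed M) :
  pure [set` S] setT -> pure_embedding (val : {linear submod S -> M}).
Proof.
move=> [_ pS]; apply/pure_embeddingP; split=> [|p q B w v E]; first exact: val_inj.
have [//|j|w' [Sw' E']] := pS _ _ B w; first by rewrite E; exact: valP.
exists (fun k => Sub (w' k) (Sw' k)); apply/funext => j; apply: val_inj.
have -> : val (v j) = (val \o v) j by [].
rewrite -E -E' -[LHS]/(((val : {linear submod S -> M}) \o act B _) j) -act_map.
by congr (act B _ j); apply/funext.
Qed.

(** A relation of N lifts to M up to an error in the kernel; purity of the kernel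
    allows to correct the lift by elements of the kernel so that it becomes a
    relation of M. *)
Lemma flat_surj (M N : lmodType R) (f : {linear M -> N}) :
  (forall y, exists x, f x = y) -> pure [set x | f x = 0] setT ->
  flat M -> flat N.
Proof.
move=> /choice[g gK] [_ pf] /flatP flatM; apply/flatP => p n A m Am0.
have mE : m = f \o (g \o m) by apply/funext => i /=; rewrite gK.
have [//|j|w [fw0 Ew]] := pf _ _ A (g \o m).
  by rewrite /= -[LHS]/((f \o act A (g \o m)) j) -act_map -mE Am0.
have [|q [C [z [zE AC]]]] := flatM _ _ A (g \o m - w).
  by rewrite actB Ew subrr.
exists q, C, (f \o z); split=> //; rewrite act_map -zE mE.
apply/funext => i /=; rewrite -[in RHS]/(g (m i) - w i) linearB /=.
by rewrite fw0 subr0 gK.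
Qed.

Lemma flat_prod (M N : lmodType R) : flat M -> flat N -> flat (M * N)%type.
Proof.
move=> /flatP flatM /flatP flatN; apply/flatP => p n A m Am0.
pose f1 : {linear (M * N)%type -> M} := fst.
pose f2 : {linear (M * N)%type -> N} := snd.
have [|q [C [z [zE AC]]]] := flatM _ _ A (f1 \o m).
  by rewrite act_map Am0; apply/funext => j.
have [|q' [C' [z' [zE' AC']]]] := flatN _ _ A (f2 \o m).
  by rewrite act_map Am0; apply/funext => j.
exists (q + q')%N, (row_mx C C'), (vcat (fun k => (z k, 0)) (fun k => (0, z' k))).
split; last by rewrite mul_mx_row AC AC' row_mx0.
rewrite act_row_mx; apply/funext => i.
rewrite -[RHS]/(act C _ i + act C' _ i).
have E1 (y : (M * N)%type) : y = (f1 y, f2 y) by case: y.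
rewrite [LHS]E1 [RHS]E1 !linearD /=.
have F1 a b (D : 'M_(a, b)) v k : f1 (act D v k) = act D (f1 \o v) k.
  by rewrite act_map.
have F2 a b (D : 'M_(a, b)) v k : f2 (act D v k) = act D (f2 \o v) k.
  by rewrite act_map.
congr (_, _).
  rewrite -[LHS]/((f1 \o m) i) zE.
  rewrite -[X in _ = X + _]/(f1 _) -[X in _ = _ + X]/(f1 _) !F1.
  rewrite -[X in _ = _ + X]/(act C' 0 i) act0 addr0.
  by congr (act C _ i).
rewrite -[LHS]/((f2 \o m) i) zE'.
rewrite -[X in _ = X + _]/(f2 _) -[X in _ = _ + X]/(f2 _) !F2.
by rewrite -[X in _ = X + _]/(act C 0 i) act0 add0r.
Qed.

End Pure.

Section QuotientModule.
Local Open Scope quotient_scope.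
Context (R : pzRingType) (M : lmodType R) (U : submodClosed M).

(** Quotient groups are formed by predicates bundled with closure under opposites,
    which a submodule predicate has only through scaling by -1. *)
Definition sub_mem : {pred M} := fun x => x \in U.

Lemma sub_mem_closed : zmod_closed sub_mem.
Proof.
split=> [|x y Ux Uy]; first exact: rpred0.
exact: (is_submodB (submodClosed_is_submodule U)).
Qed.

HB.instance Definition _ := GRing.isZmodClosed.Build M sub_mem sub_mem_closed.

Definition quotm : Type := @Quotient.quot M sub_mem.

HB.instance Definition _ := GRing.Zmodule.on quotm.
HB.instance Definition _ := EqQuotient.on quotm.

Definition quotm_map (x : M) : quotm := \pi_(@Quotient.quot M sub_mem) x.

Lemma quotm_mapP x y : quotm_map x = quotm_map y <-> x - y \in U.
Proof.
by rewrite -[x - y \in U]/(x - y \in sub_mem) Quotient.idealrBE; split=> /eqP.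
Qed.

Lemma quotm_surj (y : quotm) : exists x, quotm_map x = y.
Proof. by exists (repr (y : @Quotient.quot M sub_mem)); exact: reprK. Qed.

Lemma quotm_mapB : zmod_morphism quotm_map.
Proof. by move=> x y; exact: (raddfB (\pi_(@Quotient.quot M sub_mem))). Qed.

Definition quotm_scale (a : R) (x : quotm) : quotm :=
  quotm_map (a *: repr (x : @Quotient.quot M sub_mem)).

Lemma quotm_scaleE a x : quotm_scale a (quotm_map x) = quotm_map (a *: x).
Proof.
apply/quotm_mapP; rewrite -scalerBr; apply: rpredZ; apply/quotm_mapP.
exact: reprK.
Qed.

Lemma quotm_scaleA a b x :
  quotm_scale a (quotm_scale b x) = quotm_scale (a * b) x.
Proof. by have [y <-] := quotm_surj x; rewrite !quotm_scaleE scalerA. Qed.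

Lemma quotm_scale1 : left_id 1 quotm_scale.
Proof. by move=> x; have [y <-] := quotm_surj x; rewrite quotm_scaleE scale1r. Qed.

Lemma quotm_scaleDr : right_distributive quotm_scale +%R.
Proof.
move=> a x y; have [u <-] := quotm_surj x; have [v <-] := quotm_surj y.
by rewrite -(zmorphD quotm_mapB) !quotm_scaleE scalerDr (zmorphD quotm_mapB).
Qed.

Lemma quotm_scaleDl x : {morph quotm_scale^~ x : a b / a + b}.
Proof.
move=> a b; have [u <-] := quotm_surj x.
by rewrite !quotm_scaleE scalerDl (zmorphD quotm_mapB).
Qed.

HB.instance Definition _ := GRing.Zmodule_isLmodule.Build R quotm
  quotm_scaleA quotm_scale1 quotm_scaleDr quotm_scaleDl.

Lemma quotm_map_linear : linear quotm_map.
Proof.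
move=> a x y; rewrite (zmorphD quotm_mapB); congr (_ + _).
by rewrite -[RHS]/(quotm_scale a (quotm_map x)) quotm_scaleE.
Qed.

HB.instance Definition _ :=
  GRing.isLinear.Build R M quotm *:%R quotm_map quotm_map_linear.

End QuotientModule.

(** * A Loewenheim-Skolem theorem for systems of linear equations *)

Section LowenheimSkolem.
Context (R : pzRingType) (E : lmodType R) (W U : nat -> set E).

(** The system B w = v, to be solved in W b and modulo U b; the index b allows
    several pairs (W b, U b) to be treated at once. *)
Definition solves b p q (B : 'M[R]_(p, q)) (v : 'I_p -> E) (w : 'I_q -> E) :=
  (forall k, W b (w k)) /\ forall j, U b (act B w j - v j).

(** (b, p, q, s): the index b and a p x q matrix encoded by the list s of its
    rows.  A list keeps the dimensions out of the type. *)
Definition skolem_code : Type := (nat * nat * nat * seq (seq R))%type.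

Definition decode_mx p q (s : seq (seq R)) : 'M[R]_(p, q) :=
  \matrix_(i, j) (nth [::] s i)`_j.

Lemma decode_mxK p q (B : 'M[R]_(p, q)) : exists s, decode_mx p q s = B.
Proof.
exists [seq [seq B i j | j <- enum 'I_q] | i <- enum 'I_p].
apply/matrixP => i j; rewrite mxE (nth_map i) ?size_enum_ord //.
by rewrite (nth_map j) ?size_enum_ord // !nth_ord_enum.
Qed.

(** The terms over x of the language with the module operations and, for each
    code c and position k, the Skolem function giving the k-th coordinate of a
    solution.  Generic trees serve as syntax so that their number is bounded by
    embeds_tree. *)
Definition skolem_eval (x : E) (sol : skolem_code -> seq E -> nat -> E) :=
  fix eval (t : GenTree.tree (R + (skolem_code * nat))) : E :=
  match t with
  | GenTree.Node 0 _ => x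
  | GenTree.Node 1 (GenTree.Leaf (inl r) :: t :: u :: _) => r *: eval t + eval u
  | GenTree.Node _ (GenTree.Leaf (inr (c, k)) :: ts) => sol c (map eval ts) k
  | _ => 0
  end.

(** G is the set of values of all terms, hence closed under Skolem functions. *)
Lemma lowenheim_skolem (x : E) : exists G : set E,
  [/\ is_submodule G, G x, embeds {y | G y} (R + nat) &
    forall b p q (B : 'M[R]_(p, q)) v, (forall i, G (v i)) ->
      (exists w, solves b B v w) ->
      exists w, (forall k, G (w k)) /\ solves b B v w].
Proof.
have [sol solP] : exists sol : skolem_code -> seq E -> nat -> E,
    forall b p q s v, (exists w, solves b (decode_mx p q s) (fun i => v`_i) w) ->
      solves b (decode_mx p q s) (fun i => v`_i) (fun k : 'I_q => sol (b, p, q, s) v k).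
  have /choice[sol solP] : forall cv : skolem_code * seq E, exists y : nat -> E,
      let: (b, p, q, s, v) := cv in
      (exists w, solves b (decode_mx p q s) (fun i => v`_i) w) ->
      solves b (decode_mx p q s) (fun i => v`_i) (fun k : 'I_q => y k).
    move=> [[[[b p] q] s] v].
    have [[w wP]|nw] := pselect (exists w, solves b (decode_mx p q s) (fun i => v`_i) w).
      exists (fun n => if insub n is Some k then w k else 0) => _.
      by congr solves: wP; apply/funext => k; rewrite valK.
    by exists (fun=> 0).
  exists (fun c v => sol (c, v)) => b p q s v; exact: (solP (b, p, q, s, v)).
exists (range (skolem_eval x sol)); split.
- split; first by exists (GenTree.Node 2 [::]).
  move=> r _ _ [t _ <-] [u _ <-].
  by exists (GenTree.Node 1 [:: GenTree.Leaf (inl r); t; u]).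
- by exists (GenTree.Node 0 [::]).
- have Kinf : embeds nat (R + nat) by exists inr => ? ? [].
  have RK : embeds R (R + nat) by exists inl => ? ? [].
  apply: (@embeds_trans (GenTree.tree (R + (skolem_code * nat)))).
    apply: (@embeds_surj _ _ (fun t => exist _ (skolem_eval x sol t) (imageT _ t))).
    by move=> [y yG]; have [t _ ty] := yG; exists t; exact: eq_exist.
  apply: embeds_tree => //; rewrite /skolem_code.
  do ?[done|apply: embeds_sum|apply: embeds_mul|apply: embeds_seq].
- move=> b p q B v Gv [w wP].
  have /choice[t tE] i : exists t, skolem_eval x sol t = v i.
    by have [t _ <-] := Gv i; exists t.
  have [s sB] := decode_mxK B; pose vs := [seq v i | i <- enum 'I_p].
  have vsE (i : 'I_p) : vs`_i = v i by rewrite (nth_map i) ?size_enum_ord // nth_ord_enum.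
  exists (fun k : 'I_q => sol (b, p, q, s) vs k); split=> [k|].
    exists (GenTree.Node 2 (GenTree.Leaf (inr (b, p, q, s, val k)) ::
      [seq t i | i <- enum 'I_p])) => //=.
    rewrite -map_comp; congr (sol _ _ _).
    by apply: eq_map => i /=; rewrite -tE.
  have := solP b p q s vs; rewrite sB.
  have -> : (fun i : 'I_p => vs`_i) = v by apply/funext => i; exact: vsE.
  by apply; exists w.
Qed.

End LowenheimSkolem.

(** * Extending homomorphisms from pure submodules of flat modules *)

Lemma linear_pack (R : pzRingType) (M N : lmodType R) (f : M -> N) :
  linear f -> exists g : {linear M -> N}, g =1 f.
Proof.
move=> fL; pose fA := GRing.isLinear.Build R M N *:%R f fL.
by exists (HB.pack f fA : {linear M -> N}).
Qed.

Lemma chain_finite (T : Type) (F : set (set T)) n (x : 'I_n -> T) :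
  F !=set0 -> total_on F subset -> (forall i, (\bigcup_(X in F) X) (x i)) ->
  exists X, F X /\ forall i, X (x i).
Proof.
move=> [X0 FX0] Ftot; elim: n x => [|n IH] x Fx.
  by exists X0; split=> // -[].
have [X [FX Xx]] := IH (fun i => x (fintype.lift ord0 i)) (fun i => Fx _).
have [Y FY Yx] := Fx ord0.
have [XY|YX] := Ftot _ _ FX FY; [exists Y|exists X]; split=> // i.
  by have [j ->|->] := unliftP ord0 i => //; exact/XY/Xx.
by have [j ->|->] := unliftP ord0 i; [exact: Xx|exact: YX].
Qed.

Section Pair.
Context (R : pzRingType) (M N : lmodType R).

Definition pairl (x : M) : (M * N)%type := (x, 0).
Definition pairr (y : N) : (M * N)%type := (0, y).

Lemma pairl_linear : linear pairl.
Proof. by move=> a x y; apply/eqP/andP; rewrite /= scaler0 addr0 !eqxx. Qed.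

Lemma pairr_linear : linear pairr.
Proof. by move=> a x y; apply/eqP/andP; rewrite /= scaler0 addr0 !eqxx. Qed.

HB.instance Definition _ :=
  GRing.isLinear.Build R M (M * N)%type *:%R pairl pairl_linear.
HB.instance Definition _ :=
  GRing.isLinear.Build R N (M * N)%type *:%R pairr pairr_linear.

Lemma fst_act m n (A : 'M[R]_(m, n)) (v : 'I_n -> (M * N)%type) j :
  (act A v j).1 = act A (fun i => (v i).1) j.
Proof. exact/esym/(congr1 (@^~ j) (act_map (fst : {linear (M * N)%type -> M}) A v)). Qed.

Lemma snd_act m n (A : 'M[R]_(m, n)) (v : 'I_n -> (M * N)%type) j :
  (act A v j).2 = act A (fun i => (v i).2) j.
Proof. exact/esym/(congr1 (@^~ j) (act_map (snd : {linear (M * N)%type -> N}) A v)). Qed.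

End Pair.

Lemma val_act (R : pzRingType) (M : lmodType R) (S : submodClosed M) m n
    (A : 'M[R]_(m, n)) (v : 'I_n -> submod S) j :
  val (act A v j) = act A (fun i => val (v i)) j.
Proof. exact/esym/(congr1 (@^~ j) (act_map (val : {linear submod S -> M}) A v)). Qed.

Section Extension.
Context (R : pzRingType) (L : Type).

(** The universality of T over S, without the conditions on cardinalities. *)
Definition realizes (N : lmodType R) (S T : submodClosed N) : Prop :=
  forall (Q : lmodType R) (j : {linear submod S -> Q}),
    flat Q -> embeds Q L -> pure_embedding j ->
    exists f : {linear Q -> submod T},
      pure_embedding f /\ forall x : submod S, f (j x) = x :> N.

(** What is used of a limit model of length |R + nat|^+: small subsets lie in a
    small flat S over which some T, pure in N, is universal. *)
Definition saturated (N : lmodType R) : Prop :=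
  forall X (f : X -> N), embeds X (R + nat) -> exists S T : submodClosed N,
    [/\ forall x, f x \in S, flat (submod S), embeds (submod S) L,
        pure [set` T] setT & realizes S T].

Definition dom_graph (E N : Type) (G : set (E * N)) : set E :=
  [set x | exists y, G (x, y)].

(** Graphs of homomorphisms to N defined on a pure submodule of E.  Graphs rather
    than functions make unions of chains available for Zorn's lemma. *)
Definition hom_graph (E N : lmodType R) (G : set (E * N)) : Prop :=
  [/\ is_submodule (G : set (E * N)%type), forall y, G (0, y) -> y = 0 &
      pure (dom_graph G) setT].

Hypothesis Linf : embeds nat L.
Hypothesis KL : embeds (R + nat) L.

Lemma hom_graph_fun (E N : lmodType R) (G : set (E * N)) x y y' :
  hom_graph G -> G (x, y) -> G (x, y') -> y = y'.
Proof.
move=> [sG G0 _] Gy Gy'; apply/eqP; rewrite -subr_eq0; apply/eqP/G0.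
by rewrite -[0](subrr x); exact: (is_submodB sG Gy Gy').
Qed.

Lemma dom_graph_submodule (E N : lmodType R) (G : set (E * N)) :
  is_submodule (G : set (E * N)%type) -> is_submodule (dom_graph G).
Proof.
move=> [G0 GL]; split=> [|a x y [u Gu] [v Gv]]; first by exists 0.
by exists (a *: u + v); exact: (GL a _ _ Gu Gv).
Qed.

Lemma graph_act (E N : lmodType R) (G : set (E * N)) m n (A : 'M[R]_(m, n)) v w :
  is_submodule (G : set (E * N)%type) -> (forall i, G (v i, w i)) ->
  forall j, G (act A v j, act A w j).
Proof.
move=> sG Gvw j.
have := is_submod_act A sG Gvw j.
by rewrite [act _ _ _]surjective_pairing fst_act snd_act.
Qed.

(** With H a small submodule containing x, the values of G on the intersection of
    its domain with H lie in a small S.  Universality over S applied to the pushout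
    of S and H extends them to H, and hence G to the sum of its domain and H. *)
Lemma hom_graph_step (E N : lmodType R) (G : set (E * N)) (x : E) :
  saturated N -> flat E -> hom_graph G ->
  exists G', [/\ hom_graph G', G `<=` G' & dom_graph G' x].
Proof.
move=> satN flatE hG; have [sG G0 [_ pG]] := hG.
pose D := dom_graph G; have sD : is_submodule D by exact: dom_graph_submodule.
(* Case 0 makes H pure in E, case 1 makes D + H pure in E (solutions modulo D),
   and case 2 makes the intersection of D and H pure (solutions in D). *)
pose W (b : nat) : set E := if b is 2 then D else setT.
pose U (b : nat) : set E := if b is 1 then D else [set 0].
have [H [sH Hx HK Hsol]] := lowenheim_skolem W U x.
have pH : pure H setT.
  split=> // p q B w _ Hw; have [|w' [Hw' [_ E']]] := Hsol 0 p q B (act B w) Hw.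
    by exists w; split=> // j; rewrite /= subrr.
  by exists w'; split=> //; apply/funext => j; exact/subr0_eq/E'.
pose HS := mksub sH; pose HM : lmodType R := submod HS.
have HSE : [set` HS] = H by exact: mksubE.
have HP (g : HM) : H (val g) by have /mksubP := valP g.
have flatH : flat HM.
  by apply: flat_pure_embedding flatE; apply: pure_submod; rewrite HSE.
have embH : embeds HM (R + nat).
  apply: embeds_trans HK; exists (fun g : HM => exist _ (val g) (HP g)).
  by move=> g g' [] /val_inj.
pose X := {g : HM | D (val g)}.
have /choice[f fG] : forall g : X, exists y, G (val (proj1_sig g), y).
  by move=> [g [y Gy]]; exists y.
have [|S [T [fS flatS SL pT ST]]] := satN X f.
  apply: embeds_trans embH; exists (@proj1_sig _ _) => g g'.
  exact: eq_sig_hprop.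
have GS (g : HM) y : G (val g, y) -> y \in S.
  move=> Gy; have Dg : D (val g) by exists y.
  by rewrite (hom_graph_fun hG Gy (fG (exist _ g Dg))).
(* Systems solvable in H whose constants lie in D are solvable in the
   intersection, on which G takes values in S. *)
have key p q (B : 'M[R]_(p, q)) (w : 'I_q -> HM) (v : 'I_p -> N) :
    (forall j, G (val (act B w j), v j)) ->
    exists (w' : 'I_q -> HM) (y : 'I_q -> submod S),
      [/\ forall k, G (val (w' k), val (y k)), act B w' = act B w &
          forall j, val (act B y j) = v j].
  move=> Gv; have [//|j|w1 [Dw1 E1]] := pG _ _ B (fun k => val (w k)).
    by exists (v j); rewrite -val_act.
  have [j||w' [Hw' [Dw' E']]] := Hsol 2 p q B (fun j => val (act B w j)).
  - exact: HP.
  - by exists w1; split=> // j /=; rewrite E1 val_act subrr.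
  - have Hw2 k : w' k \in HS by apply/mksubP.
    have /choice[y Gy] : forall k, exists y, G (w' k, y) by move=> k; exact: Dw'.
    have Sy k : y k \in S by apply: (@GS (Sub (w' k) (Hw2 k))); exact: Gy.
    exists (fun k => Sub (w' k) (Hw2 k)), (fun k => Sub (y k) (Sy k)).
    have Ew : act B (fun k => Sub (w' k) (Hw2 k) : HM) = act B w.
      by apply/funext => j; apply/val_inj/subr0_eq; rewrite val_act; exact: E'.
    split=> // j.
    apply: (hom_graph_fun hG _ (Gv j)).
    by rewrite -Ew !val_act; exact: graph_act.
(* Q is the pushout of S and H over their common part: (0, g) is identified with
   (y, 0) whenever G (g, y). *)
pose SM : lmodType R := submod S.
pose WM : lmodType R := (SM * HM)%type.
pose V : set WM := [set u | G (val u.2, - val u.1)].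
have sV : is_submodule V.
  split=> [|a u v Gu Gv]; rewrite /V /=.
    by rewrite !linear0; case: sG.
  by rewrite !linearD !linearZ /=; exact: (sG.2 a _ _ Gu Gv).
pose VS := mksub sV; pose Q : lmodType R := quotm VS.
pose pi : {linear WM -> Q} := @quotm_map R WM VS.
have piP u v : pi u = pi v <-> V (u - v).
  by rewrite quotm_mapP; exact: mksubP.
have pi0 u : pi u = 0 <-> V u by rewrite -(linear0 pi) piP subr0.
have flatQ : flat Q.
  apply: (@flat_surj _ _ _ pi); [exact: quotm_surj| |exact: flat_prod].
  split=> // p q B w _ Vw.
  have [|w' [y [Gwy Ew Ey]]] := key _ _ B (fun k => (w k).2)
      (fun j => - val (act B (fun k => (w k).1) j)).
    move=> j; rewrite -snd_act -fst_act.
    exact/(pi0 (act B w j)).1/Vw.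
  exists (fun k => (- y k, w' k)); split=> [k|].
    by apply/(pi0 _).2; rewrite /V /= linearN opprK; exact: Gwy.
  apply/funext => j; rewrite [LHS]surjective_pairing [RHS]surjective_pairing.
  rewrite !snd_act !fst_act /= Ew; congr (_, _).
  rewrite -[LHS]/(act B (- y) j) actN.
  by apply: val_inj; rewrite -[LHS]/(val (- act B y j)) linearN /= Ey opprK.
pose j : {linear SM -> Q} := pi \o @pairl R SM HM.
have pj : pure_embedding j.
  apply/pure_embeddingP; split=> [y y' /piP|p q B w v E1].
    rewrite -[V _]/(G (val (0 - 0 : HM), - val (y - y' : SM))) subr0 linear0.
    move=> /G0 /eqP; rewrite oppr_eq0 linearB subr_eq0.
    by move/eqP/val_inj.
  have /choice[u uE] : forall k, exists u, pi u = w k by move=> k; exact: quotm_surj.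
  have [|w' [y [Gwy Ew Ey]]] := key _ _ B (fun k => (u k).2)
      (fun i => - val (act B (fun k => (u k).1) i - v i)).
    move=> i; have : V (act B u i - pairl HM (v i)).
      apply/piP; rewrite -[RHS]/((j \o v) i) -E1.
      have -> : w = pi \o u by apply/funext => k /=; rewrite uE.
      by rewrite act_map.
    by rewrite /V /= subr0 -snd_act -fst_act.
  exists ((fun k => (u k).1) + y); rewrite actD; apply/funext => i.
  rewrite -[LHS]/(act B (fun k => (u k).1) i + act B y i).
  have -> : act B y i = v i - act B (fun k => (u k).1) i.
    by apply: val_inj; rewrite Ey -(linearN (val : {linear SM -> N})) opprB.
  by rewrite addrC subrK.
have QL : embeds Q L.
  apply: (@embeds_trans WM).
    by apply: (@embeds_surj _ _ pi); exact: quotm_surj.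
  by apply: embeds_mul => //; exact: embeds_trans embH KL.
have [F [_ FE]] := ST Q j flatQ QL pj.
(* e is the restriction to H of the embedding of Q over S; it agrees with G on
   the intersection, so that G and e define a homomorphism on D + H. *)
pose e (g : HM) : N := val (F (pi (pairr SM g))).
have eL a g g' : e (a *: g + g') = a *: e g + e g' by rewrite /e !linearP.
have eG (g : HM) y : G (val g, y) -> e g = y.
  move=> Gy; have Sy := GS _ _ Gy; rewrite /e.
  have -> : pi (pairr SM g) = j (Sub y Sy).
    apply/piP; rewrite /V /= subr0 sub0r opprK; exact: Gy.
  exact: FE.
pose G' : set (E * N) := [set p | exists b y g,
  G (b, y) /\ p = (b + val g, y + e g)].
have sG' : is_submodule (G' : set (E * N)%type).
  split=> [|a _ _ [b [y [g [Gb ->]]]] [b' [y' [g' [Gb' ->]]]]].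
    exists 0, 0, 0; split; first by case: sG.
    have e0 : e 0 = 0 by rewrite /e !linear0.
    by rewrite e0 linear0 !addr0.
  exists (a *: b + b'), (a *: y + y'), (a *: g + g'); split.
    exact: (sG.2 a _ _ Gb Gb').
  rewrite eL linearP.
  rewrite -[LHS]/(a *: (b + val g) + (b' + val g'), a *: (y + e g) + (y' + e g')).
  by rewrite !scalerDr; congr (_, _); exact: addrACA.
exists G'; split.
- split=> // [_ [b [y [g [Gb [/eqP E0 ->]]]]]|].
    have Eg : val (- g) = b.
      by rewrite linearN; apply/eqP; rewrite eq_sym -addr_eq0 eq_sym.
    rewrite -(eG (- g) y); last by rewrite Eg.
    have eN : e (- g) = - e g by rewrite /e !linearN.
    by rewrite eN addNr.
  split=> // p q B w _ Gw.
  (* Write the constants as b + g.  First solve the system with constants g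
     modulo D inside H, then the remaining one inside D. *)
  have /choice[b bP] : forall i, exists b, exists g : HM, D b /\
      act B w i = b + val g.
    move=> i; have [_ [b [y [g [Gb [-> _]]]]]] := Gw i.
    by exists b, g; split=> //; exists y.
  have /choice[g gP] := bP.
  have [i||w' [Hw' [_ Dw']]] := Hsol 1 p q B (fun i => val (g i)).
  - exact: HP.
  - by exists w; split=> // i; have [Db ->] := gP i; rewrite /= addrK.
  - have [//|i|w'' [Dw'' E'']] := pG _ _ B (w - w').
      suff : D (act B w i - act B w' i) by rewrite actB.
      have [Db ->] := gP i.
      have := Dw' i; rewrite /= => DD.
      have -> : b i + val (g i) - act B w' i = b i - (act B w' i - val (g i)).
        by rewrite opprB addrA.
      exact: is_submodB.
    exists (w'' + w'); split; last by rewrite actD E'' actB subrK.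
    move=> k; have [y Gy] := Dw'' k.
    have Hk : w' k \in HS by apply/mksubP.
    by exists (y + e (Sub (w' k) Hk)), (w'' k), y, (Sub (w' k) Hk).
- move=> [b y] Gb; exists b, y, 0; split=> //.
  have e0 : e 0 = 0 by rewrite /e !linear0.
  by rewrite e0 linear0 !addr0.
- have Hx' : x \in HS by apply/mksubP.
  exists (e (Sub x Hx')), 0, 0, (Sub x Hx'); split; first by case: sG.
  by rewrite !add0r.
Qed.

(** By hom_graph_step, a maximal graph has domain E. *)
Lemma hom_graph_extend (E N : lmodType R) (G : set (E * N)) :
  saturated N -> flat E -> hom_graph G ->
  exists h : {linear E -> N}, forall x y, G (x, y) -> h x = y.
Proof.
move=> satN flatE hG.
have [//||H [GH hH Hmax]] := @Zorn_above _ (@hom_graph E N) G.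
  move=> F F0 FP Ftot; set U := \bigcup_(X in F) X.
  have sub X : F X -> X `<=` U by move=> FX z Xz; exists X.
  have pair z z' : U z -> U z' -> exists X, [/\ F X, X z & X z'].
    move=> [Y FY Yx] [Z FZ Zy].
    by have [YZ|ZY] := Ftot _ _ FY FZ; [exists Z|exists Y]; split=> //;
      [exact: YZ|exact: ZY].
  split.
  - split; first by have [X FX] := F0; exists X => //; have [[]] := FP _ FX.
    move=> a z z' Uz Uz'; have [X [FX Xz Xz']] := pair _ _ Uz Uz'.
    by exists X => //; have [[_ XL] _ _] := FP _ FX; exact: XL.
  - by move=> y [X /FP[_ X0 _] /X0].
  - split=> // p q B w _ /choice[y Uy].
    have [X [FX Xy]] := chain_finite F0 Ftot Uy.
    have [_ _ [_ pX]] := FP _ FX.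
    have [//|j|w' [Xw' Ew']] := pX _ _ B w; first by exists (y j).
    exists w'; split=> // k; have [u Xu] := Xw' k.
    by exists u; exact: sub Xu.
have /choice[h hP] : forall x, exists y, H (x, y).
  move=> x; have [H' [hH' HH' [y Hy]]] := hom_graph_step x satN flatE hH.
  by exists y; exact: (Hmax H').
have [|h' h'E] := @linear_pack R E N h.
  move=> a x y; apply: (hom_graph_fun hH (hP _)).
  by have [[_ HL] _ _] := hH; exact: (HL a _ _ (hP x) (hP y)).
by exists h' => x y /GH Hxy; rewrite h'E; exact: (hom_graph_fun hH (hP x)).
Qed.

End Extension.

(** * Limit models, back and forth, and powers of N *)

Lemma pure_embedding_pairl (R : pzRingType) (M N : lmodType R) :
  pure_embedding (@pairl R M N : {linear M -> (M * N)%type}).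
Proof.
apply/pure_embeddingP; split=> [x y []//|p q B w v E].
exists (fun k => (w k).1); apply/funext => j.
by rewrite -fst_act E.
Qed.

Lemma pure_embedding_pairr (R : pzRingType) (M N : lmodType R) :
  pure_embedding (@pairr R M N : {linear N -> (M * N)%type}).
Proof.
apply/pure_embeddingP; split=> [x y []//|p q B w v E].
exists (fun k => (w k).2); apply/funext => j.
by rewrite -snd_act E.
Qed.

Lemma embeds_setP (T L : Type) (A : set T) :
  A #<= [set: L] <-> embeds (set_type A) L.
Proof. by rewrite -(card_le_eql (card_setT A)); exact: embedsP. Qed.

Lemma embeds_submod (R : pzRingType) (M : lmodType R) (S : submodClosed M)
    (L : Type) : [set` S] #<= [set: L] -> embeds (submod S) L.
Proof.
move=> /embeds_setP; apply: embeds_trans.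
exists (fun x : submod S => SigSub (mem_set (valP x : [set` S] (val x)))).
by move=> x y /(congr1 val) /= /val_inj.
Qed.

Section Limit.
Context (R : pzRingType) (L : Type).
Hypothesis Linf : embeds nat L.

(** Universality over S applied to the pure extension S + Q of S. *)
Lemma realizes_absorbs (N : lmodType R) (S T : submodClosed N) (Q : lmodType R) :
  realizes L S T -> flat (submod S) -> embeds (submod S) L ->
  flat Q -> embeds Q L -> exists u : {linear Q -> submod T}, pure_embedding u.
Proof.
move=> ST flatS SL flatQ QL.
have [|||f [pf _]] := ST (submod S * Q)%type (@pairl R (submod S) Q).
- exact: flat_prod.
- exact: embeds_mul.
- exact: pure_embedding_pairl.
exists (f \o @pairr R (submod S) Q).
exact: pure_embedding_comp (pure_embedding_pairr _ _) pf _.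
Qed.

Section LimitChain.
Context (d : Order.disp_t) (I : orderType d) (M : lmodType R).
Variable C : I -> submodClosed M.
Hypothesis Cpure : forall i j, (i <= j)%O -> pure_sub [set` C i] [set` C j].
Hypothesis Ccover : [set: M] = \bigcup_i [set` C i].

(** A finite family of elements of M lies in some member of the chain above C i,
    in which C i is pure. *)
Lemma limit_pure i : pure [set` C i] setT.
Proof.
split=> // p q B w _ Cw.
have [||k|_ [[j _ <-] Cjw]] := @chain_finite _ (range (fun i => [set` C i])) q w.
- by exists [set` C i], i.
- move=> _ _ [j _ <-] [k _ <-].
  by have /orP[/Cpure[]|/Cpure[]] := Order.TotalTheory.le_total j k; [left|right].
- have : [set: M] (w k) by [].
  by rewrite Ccover => -[j _ Cjw]; exists [set` C j] => //; exists j.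
have [ij|/Order.POrderTheory.ltW ji] := Order.TotalTheory.leP i j.
  have /pure_subE-/(_ (submodClosed_is_submodule _))[_ pij] := Cpure ij.
  exact: pij.
have [CC _] := Cpure ji.
by exists w; split=> // k; apply: CC; exact: Cjw.
Qed.

End LimitChain.

Lemma universal_realizes (M : lmodType R) (S T : submodClosed M) :
  universal_over L S T -> realizes L S T.
Proof.
by move=> [_ _ _ ST] Q j flatQ /embedsP QL pj; exact: ST.
Qed.

(** By regularity of kappa a small subset is contained in some C k; take for T the
    next member of the chain. *)
Lemma limit_model_saturated (d : Order.disp_t) (kappa : orderType d)
    (N : lmodType R) :
  is_succ_cardinal (R + nat)%type kappa -> limit_model L kappa N ->
  saturated L N.
Proof.
move=> kE [_ lim _ [C [Cflat Cpure _ Csucc Ccover]]] X f XK.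
have /choice[i iP] x : exists i, f x \in C i.
  have : [set: N] (f x) by [].
  by rewrite Ccover => -[i _ Ci]; exists i.
have Kinf : embeds nat (R + nat) by exists inr => ? ? [].
have [k kP] := succ_cardinal_bounded Kinf kE i XK.
have [l kl] := limit_ordinal_succ k lim.
exists (C k), (C l); split.
- move=> x; have [CC _] := Cpure _ _ (Order.POrderTheory.ltW (kP x)).
  by apply: CC; exact: iP.
- by have [] := Cflat k.
- apply: embeds_submod; have [_] := Cflat k.
  by rewrite card_eq_le => /andP[].
- exact: limit_pure.
- exact/universal_realizes/Csucc.
Qed.

(** M is a union of at most lambda sets of size at most lambda. *)
Lemma limit_model_embeds (d : Order.disp_t) (I : orderType d) (M : lmodType R) :
  limit_model L I M -> embeds M L.
Proof.
move=> [_ _ /embedsP IL [C [Ccard _ _ _ Ccover]]].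
have /choice[e eI] i : exists e : M -> L,
    forall x y, x \in C i -> y \in C i -> e x = e y -> x = y.
  have [_] := Ccard i; rewrite card_eq_le => /andP[/embeds_submod[e eI] _].
  have [n0 _] := Linf.
  exists (fun x => if pselect (x \in C i) is left xC then e (Sub x xC) else n0 0).
  move=> x y xC yC; case: pselect => // ?; case: pselect => // ? /eI.
  by move/(congr1 val).
have /choice[i iP] x : exists i, x \in C i.
  have : [set: M] x by [].
  by rewrite Ccover => -[i _ Ci]; exists i.
apply: (@embeds_trans (I * L)%type).
  exists (fun x => (i x, e (i x) x)) => x y [E]; rewrite -E.
  by apply: eI => //; rewrite E.
by apply: embeds_mul => //; exists id.
Qed.

(** The properties of a chain of length omega on which back and forth relies. *)
Definition omega_limit (M : lmodType R) (C : nat -> submodClosed M) : Prop :=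
  [/\ forall n, flat (submod (C n)), forall n, embeds (submod (C n)) L,
      forall n x, x \in C n -> x \in C n.+1, forall x, exists n, x \in C n &
      forall n, realizes L (C n) (C n.+1)].

Lemma limit_model_omega (M : lmodType R) :
  limit_model L nat M -> exists C : nat -> submodClosed M, omega_limit C.
Proof.
move=> [_ _ _ [C [Cflat Cpure _ Csucc Ccover]]]; exists C; split.
- by move=> n; have [] := Cflat n.
- move=> n; apply: embeds_submod; have [_] := Cflat n.
  by rewrite card_eq_le => /andP[].
- by move=> n x; have [CC _] := Cpure n n.+1 (leqnSn n); exact: CC.
- move=> x; have : [set: M] x by [].
  by rewrite Ccover => -[i _ Ci]; exists i.
- move=> n; apply/universal_realizes/Csucc; split=> [|k]; first exact: ltnSn.
  by move=> /andP[nk]; apply/negP; rewrite -leqNgt.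
Qed.

Section BackAndForth.
Context (M M' : lmodType R) (C : nat -> submodClosed M) (C' : nat -> submodClosed M').
Hypothesis CL : omega_limit C.
Hypothesis CL' : omega_limit C'.

(** Pure embeddings of C n into C' (n+1): the forward halves of the back and
    forth. *)
Definition stage n :=
  {f : {linear submod (C n) -> submod (C' n.+1)} | pure_embedding f}.

Definition next_stage n (s : stage n) (t : stage n.+1) : Prop :=
  (forall x x', val x' = val x -> val (sval t x') = val (sval s x)) /\
  (forall y : submod (C' n.+1), exists x, val (sval t x) = val y).

(** Universality of C (n+1) over C n inverts f by some g : C' (n+1) -> C (n+1), and
    universality of C' (n+2) over C' (n+1) inverts g by the next map h.  Then h
    extends f, and its image contains C' (n+1). *)
Lemma ex_next_stage n (s : stage n) : exists t, next_stage s t.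
Proof.
have [Cflat Cle _ _ Cr] := CL; have [Cflat' Cle' _ _ Cr'] := CL'.
case: s => f pf.
have [g [pg gf]] := Cr n (submod (C' n.+1)) f (Cflat' _) (Cle' _) pf.
have [h [ph hg]] := Cr' n.+1 (submod (C n.+1)) g (Cflat _) (Cle _) pg.
exists (exist _ h ph); split=> [x x' E|y] /=.
  have -> : x' = g (f x) by apply: val_inj; rewrite E; exact/esym/gf.
  exact: hg.
by exists (g y); exact: hg.
Qed.

Lemma omega_limit_isomorphic : isomorphic M M'.
Proof.
have [Cflat Cle CS Ccov Cr] := CL; have [Cflat' Cle' CS' Ccov' Cr'] := CL'.
have [u pu] := realizes_absorbs (Cr' 0) (Cflat' 0) (Cle' 0) (Cflat 0) (Cle 0).
pose st : forall n, stage n := nat_rect stage (exist _ u pu)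
  (fun n s => sval (cid (ex_next_stage s))).
have stP n : next_stage (st n) (st n.+1) by exact: svalP (cid (ex_next_stage (st n))).
pose f n := sval (st n).
have Cmono m n x : (m <= n)%N -> x \in C m -> x \in C n.
  by move=> /subnKC <-; elim: (n - m)%N => [|k IH]; rewrite ?addn0 // addnS => /IH/CS.
have fE m n (x : submod (C m)) (x' : submod (C n)) : (m <= n)%N ->
    val x' = val x -> val (f n x') = val (f m x).
  move=> mn; move: x'; rewrite -(subnKC mn); elim: (n - m)%N => [|k IH].
    by rewrite addn0 => x' /val_inj ->.
  rewrite addnS => x' E.
  have xk : val x \in C (m + k)%N by apply: Cmono (valP x); exact: leq_addr.
  rewrite -(IH (Sub (val x) xk)) //.
  by apply: (stP (m + k)%N).1; rewrite E.
pose P x y := exists n (x' : submod (C n)), val x' = x /\ val (f n x') = y.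
have Pfun x y y' : P x y -> P x y' -> y = y'.
  move=> [m [a [ax <-]]] [n [b [bx <-]]].
  have [mn|/ltnW nm] := leqP m n; first by rewrite (fE _ _ a b) // bx.
  by rewrite (fE _ _ b a) // ax.
have Pn n x (xn : x \in C n) : P x (val (f n (Sub x xn))).
  by exists n, (Sub x xn).
have /choice[F FP] : forall x, exists y, P x y.
  by move=> x; have [n xn] := Ccov x; exists (val (f n (Sub x xn))).
have FE n x (xn : x \in C n) : F x = val (f n (Sub x xn)).
  exact: Pfun (FP x) (Pn n x xn).
have common x y : exists n, x \in C n /\ y \in C n.
  have [m xm] := Ccov x; have [n yn] := Ccov y; exists (maxn m n).
  by split; [apply: Cmono xm|apply: Cmono yn]; rewrite ?leq_maxl ?leq_maxr.
have [|F' F'E] := @linear_pack R M M' F.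
  move=> a x y; have [n [xn yn]] := common x y.
  have axy : a *: x + y \in C n.
    exact: (submodClosed_is_submodule (C n)).2.
  rewrite (FE _ _ xn) (FE _ _ yn) (FE _ _ axy).
  have -> : Sub (a *: x + y) axy = a *: Sub x xn + Sub y yn :> submod (C n).
    by apply: val_inj; rewrite linearP.
  by rewrite !linearP.
exists F'.
have FI : injective F'.
  move=> x y; rewrite !F'E; have [n [xn yn]] := common x y.
  rewrite (FE _ _ xn) (FE _ _ yn) => /val_inj.
  have [fI _] := svalP (st n).
  by move=> /fI /(congr1 val).
have /choice[G GP] : forall y, exists x, F' x = y.
  move=> y; have [n /CS' yn] := Ccov' y.
  have [x E] := (stP n).2 (Sub y yn).
  exists (val x); rewrite F'E (FE _ _ (valP x)).
  have -> : Sub (val x) (valP x) = x by exact: val_inj.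
  exact: E.
by exists G => // x; apply: FI; rewrite GP.
Qed.

End BackAndForth.

Section Powers.
Context (N : lmodType R).
Let D := direct_sum nat N.

Definition coord (k : nat) (x : D) : N := val x k.

Lemma coord_linear k : linear (coord k).
Proof. by move=> a x y; rewrite /coord linearP. Qed.

HB.instance Definition _ k :=
  GRing.isLinear.Build R D N *:%R (coord k) (coord_linear k).

Lemma coord_ext (x y : D) : (forall k, coord k x = coord k y) -> x = y.
Proof. by move=> E; apply: val_inj; apply/funext => k; exact: E. Qed.

Lemma coord_bound (x : D) : exists n, forall k, (n <= k)%N -> coord k x = 0.
Proof.
have /asboolP /finite_seqP[s sE] := valP x.
exists (\max_(i <- s) i.+1) => k nk; apply/eqP; apply: contraPT nk => xk.
have ks : k \in s.
  by have : [set` s] k by rewrite -sE.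
by apply/negP; rewrite -ltnNge; exact: (@leq_bigmax_seq _ s xpredT S k ks).
Qed.

Lemma cut_subproof n (g : nat -> N) :
  (fun i => if (i < n)%N then g i else 0) \in @finsupp_pred R nat N.
Proof.
apply/asboolP; apply: (@sub_finite_set _ _ `I_n) => [i /=|]; last exact: finite_II.
by case: ifP => //; rewrite eqxx.
Qed.

Definition cut n (g : nat -> N) : D := Submod (cut_subproof n g).

Lemma coord_cut k n g : coord k (cut n g) = if (k < n)%N then g k else 0.
Proof. by []. Qed.

Definition below n : set D := [set x | forall k, (n <= k)%N -> coord k x = 0].

Lemma below_submodule n : is_submodule (below n).
Proof.
split=> [k _|a x y xn yn k nk]; first exact: linear0.
by rewrite linearP /= xn // yn // scaler0 addr0.
Qed.

(** The n-th power of N, inside the direct sum. *)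
Definition power n : submodClosed D := mksub (below_submodule n).

Lemma powerP n x : x \in power n <-> forall k, (n <= k)%N -> coord k x = 0.
Proof. exact: mksubP. Qed.

Lemma cut_power n g : cut n g \in power n.
Proof. by apply/powerP => k nk; rewrite coord_cut ltnNge nk. Qed.

Definition pcut n g : submod (power n) := Sub (cut n g) (cut_power n g).

Lemma coord_pcut k n g :
  coord k (val (pcut n g)) = if (k < n)%N then g k else 0.
Proof. exact: coord_cut. Qed.

Lemma power_ext n (x y : submod (power n)) :
  (forall k, (k < n)%N -> coord k (val x) = coord k (val y)) -> x = y.
Proof.
move=> E; apply/val_inj/coord_ext => k; have [nk|/E//] := leqP n k.
by have /powerP/(_ k nk)-> := valP x; have /powerP/(_ k nk)-> := valP y.
Qed.

Lemma coord_valP n k a (x y : submod (power n)) :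
  coord k (val (a *: x + y)) = a *: coord k (val x) + coord k (val y).
Proof. exact: (linearP (coord k \o (val : {linear submod (power n) -> D}))). Qed.

Lemma pcut_linear (Q : lmodType R) n (h : nat -> {linear Q -> N}) :
  exists f : {linear Q -> submod (power n)},
    forall x k, coord k (val (f x)) = if (k < n)%N then h k x else 0.
Proof.
have [|f fE] := @linear_pack R Q _ (fun x => pcut n (fun k => h k x)).
  move=> a x y; apply: power_ext => k kn.
  by rewrite coord_valP !coord_pcut kn linearP.
by exists f => x k; rewrite fE coord_pcut.
Qed.

(** By induction on n, since power n.+1 is isomorphic to power n * N. *)
Lemma flat_power n : flat N -> flat (submod (power n)).
Proof.
move=> flatN; elim: n => [|n IH].
  apply/flatP => p q A m _; exists 0%N, 0, (fun=> 0); split; last by rewrite mulmx0.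
  by apply/funext => i; apply: power_ext.
have [f fE] := pcut_linear n
    (fun k => coord k \o (val : {linear submod (power n.+1) -> D})).
pose g : {linear submod (power n.+1) -> N} := coord n \o val.
have [|h hE] := @linear_pack R _ (submod (power n) * N)%type (fun x => (f x, g x)).
  by move=> a x y; rewrite !linearP.
apply: (@flat_pure_embedding _ _ _ h); last exact: flat_prod.
apply/pure_embeddingP; split=> [x y|p q B w v E].
  rewrite !hE => -[/(congr1 val) fxy gxy]; apply: power_ext => k.
  rewrite ltnS leq_eqVlt => /orP[/eqP ->//|kn].
  by have := congr1 (coord k) fxy; rewrite !fE kn.
exists (fun k => pcut n.+1
  (fun i => if (i < n)%N then coord i (val (w k).1) else (w k).2)).
apply/funext => j; apply: power_ext => k kn.
pose ck : {linear submod (power n.+1) -> N} := coord k \o val.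
rewrite -[LHS]/((ck \o act B _) j) -act_map.
have := congr1 (@^~ j) E; rewrite /= hE [LHS]surjective_pairing fst_act snd_act.
move=> -[E1 E2].
move: kn; rewrite ltnS leq_eqVlt => /orP[/eqP kn|kn].
  subst k; transitivity (act B (fun i => (w i).2) j); last exact: E2.
  congr (act B _ j).
  by apply/funext => i; rewrite /= coord_pcut ltnSn ltnn.
have := congr1 (fun x => coord k (val x)) E1; rewrite fE kn /= => <-.
pose dk : {linear submod (power n) -> N} := coord k \o val.
rewrite -[RHS]/((dk \o act B (fun i => (w i).1)) j) -act_map; congr (act B _ j).
by apply/funext => i; rewrite /= coord_pcut ltnS (ltnW kn) kn.
Qed.

(** The extensions h k of the coordinates from power n to Q form a retraction r,
    and f x is r x with the n-th coordinate u (x - j (r x)) added.  A solution of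
    a system in the image of f gives one in Q by summing a solution of its first
    n coordinates with a solution obtained from the purity of u. *)
Lemma power_realizes n :
  embeds (R + nat) L -> saturated L N -> realizes L (power n) (power n.+1).
Proof.
move=> KL satN Q j flatQ QL pj.
have [jI [_ jP]] := pj.
have hg k : hom_graph [set p | exists x, p = (j x, coord k (val x))].
  split.
  - split=> [|a _ _ [x ->] [y ->]].
      by exists 0; rewrite !linear0.
    by exists (a *: x + y); rewrite !linearP.
  - move=> y [x [/esym j0 ->]].
    by have -> : x = 0 by apply: jI; rewrite j0 linear0.
  - have -> : dom_graph [set p | exists x, p = (j x, coord k (val x))] = range j.
      apply/seteqP; split=> [_ [y [x [-> _]]]|_ [x _ <-]]; first by exists x.
      by exists (coord k (val x)), x.
    apply/pure_subE; last by case: pj.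
    split=> [|a _ _ [x _ <-] [y _ <-]]; first by exists 0 => //; exact: linear0.
    by exists (a *: x + y) => //; exact: linearP.
have /choice[h hP] : forall k, exists h : {linear Q -> N},
    forall x, h (j x) = coord k (val x).
  move=> k; have [h hE] := hom_graph_extend Linf KL satN flatQ (hg k).
  by exists h => x; apply: hE; exists x.
have [u pu] : exists u : {linear Q -> N}, pure_embedding u.
  have [|S [T [_ flatS SL pT ST]]] := satN False (False_rect N).
    by exists (False_rect _) => -[].
  have [u pu] := realizes_absorbs ST flatS SL flatQ QL.
  exists ((val : {linear submod T -> N}) \o u).
  exact: pure_embedding_comp pu (pure_submod pT) _.
have [r rE] := pcut_linear n h.
have rj x : r (j x) = x.
  by apply: power_ext => k kn; rewrite rE kn hP.
have [c cE] : exists c : {linear Q -> N}, forall x, c x = u (x - j (r x)).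
  have [|c cE] := @linear_pack R Q N (fun x => u (x - j (r x))).
    by move=> a x y; rewrite !linearP addrACA -scalerDr linearP.
  by exists c.
have [f fE] := pcut_linear n.+1 (fun k => if (k < n)%N then h k else c).
exists f; split; last first.
  move=> x; apply: coord_ext => k; rewrite fE ltnS; case: ltngtP => kn.
  - exact: hP.
  - by have /powerP-> := valP x; rewrite // ltnW.
  - rewrite cE rj subrr linear0.
    by have /powerP-> := valP x; rewrite // kn.
have fr x k : (k < n)%N -> coord k (val (f x)) = coord k (val (r x)).
  by move=> kn; rewrite fE rE kn ltnW.
have fc x : coord n (val (f x)) = c x by rewrite fE ltnSn ltnn.
apply/pure_embeddingP; have /pure_embeddingP[uI uP] := pu; split.
  apply: raddf_inj => x fx0.
  have rx0 : r x = 0.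
    by apply: power_ext => k kn; rewrite -fr // fx0 !linear0.
  apply: uI; rewrite linear0 -[X in u X]subr0 -[X in _ - X](linear0 j) -rx0 -cE -fc.
  by rewrite fx0 !linear0.
move=> p q B w v E.
have [t tE] := pcut_linear n
  (fun k => coord k \o (val : {linear submod (power n.+1) -> D})).
have [|w' E'] := uP _ _ B (fun k => coord n (val (w k))) (v - (j \o (r \o v))).
  pose cn : {linear submod (power n.+1) -> N} := coord n \o val.
  rewrite -[X in act B X]/(cn \o w) act_map E; apply/funext => i.
  by rewrite -[LHS]/(coord n (val (f (v i)))) fc cE.
exists ((j \o (t \o w)) + w'); rewrite actD E' !act_map E.
apply/funext => i; rewrite -[LHS]/(j (t (f (v i))) + (v i - j (r (v i)))).
have -> : t (f (v i)) = r (v i).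
  by apply: power_ext => k kn; rewrite tE kn; exact: fr.
by rewrite addrC subrK.
Qed.

Lemma power_omega_limit :
  flat N -> embeds N L -> embeds (R + nat) L -> saturated L N ->
  omega_limit power.
Proof.
move=> flatN NL KL satN; split.
- by move=> n; exact: flat_power.
- move=> n; apply: (@embeds_trans (seq N)); last exact: embeds_seq.
  exists (fun x => mkseq (fun k => coord k (val x)) n) => x y E.
  by apply: power_ext => k kn; have := congr1 (nth 0 ^~ k) E; rewrite !nth_mkseq.
- by move=> n x /powerP xn; apply/powerP => k /ltnW; exact: xn.
- by move=> x; have [n xn] := coord_bound x; exists n; apply/powerP.
- by move=> n; exact: power_realizes.
Qed.

End Powers.

End Limit.

Theorem lemma3p13 (R : pzRingType) (L : Type)
    (d : Order.disp_t) (kappa : orderType d)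
    (kappaE : is_succ_cardinal (R + nat)%type kappa)
    (leL : [set: kappa] #<= [set: L])
    (M N : lmodType R)
    (flatM : flat M) (flatN : flat N)
    (limM : limit_model L nat M)
    (limN : limit_model L kappa N) :
  isomorphic M (direct_sum nat N).
Proof.
have KL : embeds (R + nat) L.
  by apply: embeds_trans (succ_cardinal_embeds kappaE) _; exact/embedsP.
have Linf : embeds nat L.
  by apply: embeds_trans KL; exists inr => ? ? [].
have satN := limit_model_saturated kappaE limN.
have [C CL] := limit_model_omega limM.
have NL := limit_model_embeds Linf limN.
have powL := power_omega_limit Linf flatN NL KL satN.
have iso := omega_limit_isomorphic Linf CL powL.
exact: iso.
Qed.
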